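(* For any $\varepsilon,\delta>0$ and $B>0$ there exists a constant $C=C(\varepsilon,\delta,B)>0$ such that for every integer $N\geq 2$ and every symmetric complex-valued random variable $\mathbf{x}$ (i.e. $\mathbf{x}$ and $-\mathbf{x}$ have the same law) with $\mathbb{E}[|\mathbf{x}|^2]\leq 1$ and $\mathbb{E}[|\mathbf{x}|^{2+\varepsilon}]\leq B$, the following holds: if $X_N=(X_{i,j})_{i,j=1,\dots,N}$ is a random $N\times N$ matrix whose entries are independent copies of $\mathbf{x}$, then $$\mathbb{P}\big(\rho(X_N)\geq (1+\delta)\sqrt N\big)\leq \frac{C}{(\log N)^2}.$$
   Context: The spectral radius of a square complex matrix $A$ is $\rho(A)=\max\{|\lambda| : \lambda \text{ an eigenvalue of } A\}$. The law of $\mathbf{x}$ is allowed to depend on $N$; the constant $C$ depends only on $\varepsilon,\delta,B$. *)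

(* Defs.v *)
From HB Require Import structures.
From mathcomp Require Import all_boot all_order all_algebra.
From mathcomp Require Import all_classical all_reals all_analysis.
From mathcomp Require Import complex.

Set Implicit Arguments.
Unset Strict Implicit.
Unset Printing Implicit Defensive.

Import Order.TTheory GRing.Theory Num.Theory.
Import numFieldNormedType.Exports.

Local Open Scope classical_set_scope.
Local Open Scope ring_scope.
Local Open Scope complex_scope.

Notation normc := ComplexField.Normc.normc.

HB.instance Definition _ (R : realType) := isPointed.Build R[i] 0.

(* The Borel sigma-algebra of the complex numbers, transported from the product
   sigma-algebra of R * R: X : T -> R[i] is measurable iff its real and
   imaginary parts are. *)
Definition ReIm (R : realType) (z : R[i]) : R * R :=
  let: a +i* b := z in (a, b).

HB.instance Definition _ (R : realType) :=
  Measurable.copy R[i] (g_sigma_algebra_preimageType (@ReIm R)).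

Definition spectral_radius (R : realType) (n : nat) (A : 'M[R[i]]_n) : R :=
  sup [set normc l | l in [set l | eigenvalue A l]].

Lemma spectral_radius_max (R : realType) (n : nat) (A : 'M[R[i]]_n) :
  (0 < n)%N ->
  (exists2 l, eigenvalue A l & normc l = spectral_radius A) /\
  (forall l, eigenvalue A l -> normc l <= spectral_radius A).
Proof.
move=> n0.
have [rs def] := closed_field_poly_normal (char_poly A).
have eE l : eigenvalue A l = (l \in rs).
  rewrite eigenvalue_root_char def (monicP (char_poly_monic A)) scale1r.
  by rewrite root_prod_XsubC.
have : size rs != 0%N.
  have := size_char_poly A.
  rewrite def (monicP (char_poly_monic A)) scale1r size_prod_XsubC => -[->].
  by rewrite -lt0n.
case E : rs => [|l0 s] // _.
pose M := \big[Num.max/normc l0]_(l <- rs) normc l.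
have le l : l \in rs -> normc l <= M by move=> lrs; apply: le_bigmax_seq.
have [m mrs mM] : exists2 m, m \in rs & normc m = M.
  have key t : {subset t <= rs} ->
     exists2 m, m \in rs & normc m = \big[Num.max/normc l0]_(l <- t) normc l.
    elim: t => [|b t' IH] sub; first by exists l0; rewrite ?big_nil ?E ?mem_head.
    have [|m m1 m2] := IH; first by move=> z zt; apply: sub; rewrite inE zt orbT.
    rewrite big_cons -m2 maxEle; case: ifP => _; first by exists m.
    by exists b => //; apply: sub; rewrite mem_head.
  exact: key.
have ub : ubound [set normc l | l in [set l | eigenvalue A l]] M.
  by move=> _ [l /= + <-]; rewrite eE; exact: le.
have memM : [set normc l | l in [set l | eigenvalue A l]] M.
  by exists m => //=; rewrite eE.
have -> : spectral_radius A = M.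
  apply/eqP; rewrite eq_le; apply/andP; split.
    by apply: ge_sup => //; exists M.
  by apply: ub_le_sup => //; exists M.
by split; [exists m; rewrite ?eE|move=> l; rewrite eE; exact: le].
Qed.

Definition same_law (R : realType) (d1 d2 d' : measure_display)
    (T1 : measurableType d1) (T2 : measurableType d2) (T' : measurableType d')
    (P1 : probability T1 R) (P2 : probability T2 R)
    (X1 : T1 -> T') (X2 : T2 -> T') : Prop :=
  forall A : set T', measurable A -> P1 (X1 @^-1` A) = P2 (X2 @^-1` A).

Definition symmetric_law (R : realType) (d : measure_display)
    (T : measurableType d) (P : probability T R) (X : T -> R[i]) : Prop :=
  same_law P P X (fun w => - X w).

Definition mutually_independent (R : realType) (d d' : measure_display)
    (T : measurableType d) (T' : measurableType d') (P : probability T R)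
    (I : finType) (X : I -> T -> T') : Prop :=
  forall (J : {set I}) (A : I -> set T'),
    (forall i, measurable (A i)) ->
    P (\bigcap_(i in [set` J]) X i @^-1` A i) =
    (\prod_(i in J) P (X i @^-1` A i))%E.

(* Main.v *)
Require Import Defs.
From HB Require Import structures.
From mathcomp Require Import all_boot all_order all_algebra.
From mathcomp Require Import all_classical all_reals all_analysis.
From mathcomp Require Import complex measurable_realfun.
From mathcomp Require Import ring lra zify.

(** Flipping the signs of the entries independently does not change the law of
    the matrix, so the event may be averaged over all sign patterns first; this
    kills, in the expansion of the squared entries of [A ^+ m], every pair of
    walks in which some step is used an odd number of times.

    Put [Y e = |A e|^2] and [L = N^(1 - eta)] with [(1 - eta)(1 + eps/2) > 1].
    By Markov's inequality for the moment of order [1 + eps/2] of [Y], with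
    probability [1 - O(N^-theta)] the product of [Y] along each simple path and
    each simple cycle with [k] vertices is at most [L ^ k]. Then the largest
    product of [Y / L] along a simple path from [x] is a potential [u] with
    [1 <= u <= L] and [Y (z, x) <= L * u z / u x]. It bounds the excess powers
    in an even pair of walks with [v] vertices by [L ^ (m + 1 - v)]: only the
    first powers of [Y] on the support remain, and their products have mean at
    most [1].

    The pairs of walks are counted by exploring them in time: a step that goes
    neither to a new vertex nor along the first exit from its origin costs a
    factor polynomial in [m], and there are at most [1 + 4 (m + 1 - v)] such
    steps. The gain [N^(-eta (m + 1 - v))] absorbs this cost when [m] is of
    order [log N]. *)

Set Implicit Arguments.
Unset Strict Implicit.
Unset Printing Implicit Defensive.

Import Order.TTheory GRing.Theory Num.Theory.
Import numFieldNormedType.Exports.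

Local Open Scope classical_set_scope.
Local Open Scope ring_scope.

(** * Words and their excess *)

Section Words.
Variable V : finType.
Implicit Types (s t w : seq V) (x y z a b : V).

Fixpoint words n : seq (seq V) :=
  if n is n'.+1 then [seq y :: s | y <- enum V, s <- words n'] else [:: [::]].

Lemma mem_words n s : (s \in words n) = (size s == n).
Proof.
elim: n s => [|n IH] s /=; first by rewrite inE; case: s.
apply/allpairsP/eqP => [[[y t] [/= _ + ->]] /=|].
  by rewrite IH => /eqP ->.
case: s => // y t [sz]; exists (y, t); split => //=; first by rewrite mem_enum.
by rewrite IH sz.
Qed.

Lemma big_wordsS (R : nmodType) n (F : seq V -> R) :
  \sum_(w <- words n.+1) F w = \sum_y \sum_(s <- words n) F (y :: s).
Proof. by rewrite big_allpairs_dep /= big_enum. Qed.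

Lemma big_words0 (R : nmodType) (F : seq V -> R) :
  \sum_(w <- words 0) F w = F [::].
Proof. by rewrite big_seq1. Qed.

Lemma big_words_cat (R : nmodType) m n (F : seq V -> R) :
  \sum_(w <- words (m + n)) F w =
  \sum_(s <- words m) \sum_(t <- words n) F (s ++ t).
Proof.
elim: m F => [|m IH] F; first by rewrite big_words0.
rewrite addSn !big_wordsS; apply: eq_bigr => y _.
by rewrite (IH (fun w => F (y :: w))).
Qed.

Arguments words : simpl never.

(* A word is read backwards in time, its last letter being visited first:
   [dn s a] is the letter that follows the earliest visit to [a]. *)
Fixpoint dn s a : option V :=
  if s is y :: s' then
    if s' is z :: t then
      if (z == a) && (z \notin t) then Some y else dn s' a
    else None
  else None.

(** First exits that land on a visited vertex: the target is then one of the letters already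
    read. *)
Fixpoint bad1 s : nat :=
  if s is y :: s' then
    if s' is z :: t then ((z \notin t) && (y \in s') + bad1 s')%N else 0%N
  else 0%N.

(** Steps that leave their origin otherwise than by its first exit. A repeated first exit is
    determined by the past and costs no choice. *)
Fixpoint bad2 s : nat :=
  if s is y :: s' then
    if s' is z :: t then ((dn s z != Some y) + bad2 s')%N else 0%N
  else 0%N.

Lemma bad1_cons y z t :
  bad1 (y :: z :: t) = ((z \notin t) && (y \in z :: t) + bad1 (z :: t))%N.
Proof. by []. Qed.

Lemma bad2_cons y z t :
  bad2 (y :: z :: t) = ((dn (y :: z :: t) z != Some y) + bad2 (z :: t))%N.
Proof. by []. Qed.

Lemma dn_cons y z t a :
  dn (y :: z :: t) a = if (z == a) && (z \notin t) then Some y else dn (z :: t) a.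
Proof. by []. Qed.

Arguments dn : simpl never.
Arguments bad1 : simpl never.
Arguments bad2 : simpl never.

Lemma dn_mem s a b : dn s a = Some b -> b \in s.
Proof.
elim: s => [|y [|z t] IH] //; rewrite dn_cons.
case: ifP => _; first by move=> [->]; rewrite mem_head.
by move/IH => H; rewrite in_cons H orbT.
Qed.

(** By [dn_mem], a walk that stands on a visited vertex and follows first exits stays on visited
    vertices. Hence a step counted by [bad2] separates two steps counted by [bad1]; the boolean
    records that the walk currently stands on a visited vertex. *)
Lemma bad1_le s : (bad1 s <= bad2 s + (if s is y :: t then y \in t else false))%N.
Proof.
elim: s => [|y [|z t] IH] //; rewrite bad1_cons bad2_cons.
move: (bad1 (z :: t)) (bad2 (z :: t)) IH => b1 b2; rewrite dn_cons eqxx andTb.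
case: (boolP (z \in t)) => zt IH; last first.
  by move: IH; rewrite /= eqxx addn0; case: (y \in z :: t) => /=; lia.
case: (boolP (dn (z :: t) z == Some y)) => [/eqP/dn_mem -> |_] /=; first by lia.
by case: (y \in _); lia.
Qed.

Lemma excess_le s : (bad1 s + bad2 s <= 1 + 2 * bad2 s)%N.
Proof. by have := bad1_le s; case: s => [|y t]; try case: (y \in t); lia. Qed.

Section ExcessSum.
Variables (R : realType) (q x : R).
Hypotheses (q0 : 0 <= q) (x0 : 0 <= x) (qV : q * #|V|%:R <= 1).

(** [q] offsets the choices of a new letter, [x] is the price of a counted step. *)
Let wt s : R := q ^+ size (undup s) * x ^+ (bad1 s + bad2 s).

(** If [z] is met for the first time, the free steps go to new letters and weigh at most [1] in all
    by [qV]; otherwise the only free step is the first exit from [z]. The remaining steps pay [x]: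
    at most [size s] visited targets, and new targets for a total of one more. *)
Lemma excess_weight_step z t :
  \sum_y wt (y :: z :: t) <= wt (z :: t) * (1 + (size t).+2%:R * x).
Proof.
set s := z :: t.
have wt0 s' : 0 <= wt s' by rewrite mulr_ge0// exprn_ge0.
have card_le : \sum_y (y \in s)%:R <= (size s)%:R :> R.
  rewrite -natr_sum ler_nat (leq_trans _ (card_size s))// -sum1_card [leqRHS]big_mkcond /=.
  by apply: leq_sum => y _; case: (y \in s).
have sumq : \sum_(y : V) q <= 1 by rewrite sumr_const -mulr_natr.
have bound : \sum_y ((z \notin t)%:R * q + (z \in t)%:R * (dn s z == Some y)%:R
    + x * (y \in s)%:R + (z \in t)%:R * (q * x)) <= 1 + (size t).+2%:R * x.
  rewrite !big_split /= -!mulr_sumr.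
  have xs : x * \sum_i (i \in s)%:R <= x * (size s)%:R by rewrite ler_wpM2l.
  have ds : \sum_i (dn s z == Some i)%:R <= 1 :> R.
    case: (dn s z) => [b|]; last by rewrite big1.
    rewrite (bigD1 b)//= eqxx big1 ?addr0// => i ib.
    by rewrite (_ : Some b == Some i = false)//; apply/eqP => -[bi]; rewrite bi eqxx in ib.
  have sx : q * \sum_(i : V) x <= x.
    by rewrite sumr_const -[x *+ _]mulr_natl mulrA -[leRHS]mul1r ler_wpM2r.
  have -> : (size t).+2%:R = (size s)%:R + 1 :> R by rewrite natr1.
  move: (dn s z) (size s) xs ds => o k xs ds.
  case: (z \in t); rewrite /= !(mul0r, mul1r) ?(add0r, addr0).
    by apply: le_trans (lerD (lerD ds xs) sx) _; lra.
  by rewrite (le_trans (lerD sumq xs))// mulrDl mul1r addrA (mulrC k%:R) lerDl.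
apply: le_trans (ler_wpM2l (wt0 s) bound); rewrite mulr_sumr.
apply: ler_sum => y _.
have undupE (r : seq V) : q ^+ size (undup (y :: r)) =
    q ^+ size (undup r) * (if y \in r then 1 else q).
  by rewrite /=; case: ifP; rewrite ?mulr1//= exprSr.
have -> : wt (y :: s) = wt s * ((if y \in s then 1 else q) *
    x ^+ ((z \notin t) && (y \in s) +
          ((if z \notin t then Some y else dn s z) != Some y))).
  rewrite /wt undupE {1}/s bad1_cons bad2_cons dn_cons eqxx andTb -/s.
  rewrite (_ : forall b1 b2 m1 m2 : nat, (b1 + m1 + (b2 + m2) = m1 + m2 + (b1 + b2))%N); last by lia.
  by rewrite exprD; ring.
rewrite ler_wpM2l//.
(* Disposes of the case of a first exit lying outside [s], which the case analysis below keeps. *)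
have q1 : q <= 1.
  rewrite (le_trans _ qV)// ler_peMr// ler1n; apply/card_gt0P.
  by exists z.
move: (q0) (x0) => q0' x0'.
 have qx : 0 <= q * x by rewrite mulr_ge0.
move: (y \in s) (dn s z) => b o.
case: (z \in t); case: b; rewrite ?eqxx /= ?(eqxx, mul0r, mul1r, mulr0, mulr1, expr0, expr1); 
 try case: (o == Some y); rewrite /= ?expr0 ?expr1; lra.
Qed.

Lemma excess_weight_sum n :
  \sum_(w <- words n.+1) wt w <= (1 + n.+1%:R * x) ^+ n.
Proof.
elim: n => [|n IH].
  rewrite big_wordsS; under eq_bigr do rewrite big_words0 /wt /= expr0 mulr1 expr1.
  by rewrite expr0 sumr_const -mulr_natr.
have wt0 s' : 0 <= wt s' by rewrite mulr_ge0// exprn_ge0.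
rewrite big_wordsS exchange_big /=.
have nx : 1 + n.+1%:R * x <= 1 + n.+2%:R * x by rewrite lerD2l ler_wpM2r// ler_nat.
have nx0 : 0 <= 1 + n.+1%:R * x by rewrite addr_ge0// mulr_ge0.
apply: (@le_trans _ _ (\sum_(s <- words n.+1) wt s * (1 + n.+2%:R * x))).
  rewrite [leLHS]big_seq [leRHS]big_seq; apply: ler_sum => s.
  rewrite mem_words; case: s => // z t /eqP[<-]; exact: excess_weight_step.
rewrite -mulr_suml exprSr ler_pM//; first exact: sumr_ge0.
  by rewrite (le_trans nx0).
by rewrite (le_trans IH)// lerXn2r// nnegrE (le_trans nx0).
Qed.

End ExcessSum.

Fixpoint edges x s : seq (V * V) :=
  if s is y :: s' then (x, y) :: edges y s' else [::].

Lemma size_edges x s : size (edges x s) = size s.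
Proof. by elim: s x => //= y s IH x; rewrite IH. Qed.

Lemma edges_cat x s t : edges x (s ++ t) = edges x s ++ edges (last x s) t.
Proof. by elim: s x => //= y s IH x; rewrite IH. Qed.

Lemma edges_mem x s e : e \in edges x s -> (e.1 \in x :: s) && (e.2 \in s).
Proof.
elim: s x => //= y s IH x; rewrite inE => /predU1P[->|/IH/andP[e1 e2]] /=.
  by rewrite !mem_head.
by rewrite !(inE, e2, orbT, andbT) -in_cons e1 orbT.
Qed.

(** The first exit from a letter, once known, is not changed by later steps, so every step may be
    tested against the complete word. *)
Lemma bad2E y s :
  bad2 (y :: s) = count (fun e => dn (y :: s) e.2 != Some e.1) (edges y s).
Proof.
elim: s y => // z t IH y; rewrite bad2_cons IH /=; congr addn.
apply: eq_in_count => e /edges_mem /andP[_ e2]; rewrite dn_cons.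
by case: (z =P e.2) => // ->; rewrite e2.
Qed.

Lemma dn_some y s a : a \in s ->
  exists2 b, dn (y :: s) a = Some b & (b, a) \in edges y s.
Proof.
elim: s y => // z t IH y az; rewrite dn_cons.
have [/andP[/eqP<- _]|za] := boolP ((z == a) && (z \notin t)).
  by exists y => //=; rewrite mem_head.
have [|b -> bt] := IH z; last by exists b => //=; rewrite inE bt orbT.
by move: az za; rewrite inE => /predU1P[->|//]; rewrite eqxx /= negbK.
Qed.

(* In a closed walk using each step at least twice, each vertex accounts for
   two steps that are not bad: the repetitions of the step that followed its
   first visit. *)
Lemma bad2_vertices_le y s (c := (last y s, y) :: edges y s) :
  y \in s -> (forall e, e \in c -> (2 <= count_mem e c)%N) ->
  (bad2 (y :: s) + 2 * size (undup (y :: s)) <= size (y :: s))%N.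
Proof.
move=> ys c2; set f := dn (y :: s); set D := undup (y :: s).
have -> : size (y :: s) = size c by rewrite /= size_edges.
pose good (e : V * V) := f e.2 == Some e.1.
have le1 : (2 * size D <= count good c)%N.
  have -> : (2 * size D)%N = (\sum_(a <- D) 2)%N by rewrite big_const_seq iter_addn_0 count_predT.
  apply: (@leq_trans (\sum_(a <- D) \sum_(e <- c) ((e.2 == a) && good e))).
    rewrite big_seq [leqRHS]big_seq; apply: leq_sum => a; rewrite mem_undup => aD.
    have {}aD : a \in s by move: aD; rewrite inE => /predU1P[->|].
    have [b fb bE] := dn_some y aD.
    apply: (leq_trans (c2 (b, a) _)); first by rewrite inE bE orbT.
    rewrite -sum1_count big_mkcond; apply: leq_sum => e _ /=.
    by case: eqP => // ->; rewrite /good /= eqxx /f fb eqxx.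
  rewrite exchange_big -sum1_count [leqRHS]big_mkcond /=; apply: leq_sum => e _.
  case: (good e); last by rewrite big1_seq// => a _; rewrite andbF.
  under eq_bigr do rewrite andbT eq_sym.
  rewrite -[leqRHS]/(true : nat); apply: (@leq_trans (e.2 \in D)); last by case: (_ \in _).
  rewrite -(count_uniq_mem _ (undup_uniq _)) -sum1_count [leqRHS]big_mkcond.
  by apply: leq_sum => a _ /=; case: eqP.
have -> : size c = (count good c + count (predC good) c)%N by rewrite count_predC.
by rewrite addnC leq_add// bad2E /= leq_addl.
Qed.

(** The pairs of walks whose product of signs does not average to zero. *)
Definition even_pair x s t :=
  all (fun e => ~~ odd (count_mem e (edges x s ++ edges x t)))
      (edges x s ++ edges x t).

(** The two walks are joined into one closed walk. As they end at the same vertex, the joining step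
    and the closing step are the same [E], so every step, [E] included, is used at least twice. *)
Lemma even_pair_bad2 x s t : size s = size t -> last x s = last x t ->
  even_pair x s t ->
  (bad2 (x :: s ++ x :: t) + 2 * size (undup (x :: s ++ x :: t))
     <= 2 * (size s).+1)%N.
Proof.
move=> sz lst /allP ev.
apply: (@leq_trans (size (x :: s ++ x :: t))); last first.
  by rewrite /= size_cat /= sz; lia.
apply: bad2_vertices_le; first by rewrite mem_cat mem_head orbT.
rewrite last_cat /= edges_cat /= lst; set E := (last x t, x) => e.
set c := edges x s ++ edges x t.
have cE : count_mem e (E :: edges x s ++ E :: edges x t) = (2 * (E == e) + count_mem e c)%N.
  by rewrite /c /= !count_cat /=; lia.
rewrite -[((E == e) + _)%N]/(count_mem e (E :: edges x s ++ E :: edges x t)).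
rewrite -has_pred1 has_count cE.
case: (boolP (E == e)) => [_ _|_]; first by lia.
rewrite muln0 add0n -has_count has_pred1 => ec; have := ev _ ec.
by move: ec; rewrite -has_pred1 has_count -/c; case: (count_mem _ _) => [|[|]].
Qed.

(** Each vertex missing from the maximal number [(size s).+1] allows two steps of [bad2], hence four
    counted steps by [excess_le]. *)
Lemma even_pair_excess x s t : size s = size t -> last x s = last x t ->
  even_pair x s t -> let w := x :: s ++ x :: t in
  (bad1 w + bad2 w <= 1 + 4 * ((size s).+1 - size (undup w)))%N /\
  (size (undup w) <= (size s).+1)%N.
Proof.
by move=> sz lst ev w; have := excess_le w; have := even_pair_bad2 sz lst ev;
   rewrite -/w; lia.
Qed.

End Words.

(** * Potentials and pairs of even walks *)

Section Potential.
Variables (V : finType) (R : realType) (Y : V * V -> R) (L : R).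
Hypotheses (Y0 : forall e, 0 <= Y e) (L1 : 1 <= L).

Definition good_paths :=
  forall x s, uniq (x :: s) -> \prod_(e <- edges x s) Y e <= L ^+ (size s).+1.

Definition good_cycles := forall x s, uniq (x :: s) ->
  (\prod_(e <- edges x s) Y e) * Y (last x s, x) <= L ^+ (size s).+1.

(* [u x] is the largest product of [Y / L] along a simple path from [x]: an
   edge in front of an optimal path either prolongs it or closes a cycle. *)
Lemma potential : good_paths -> good_cycles ->
  exists u : V -> R, (forall x, 1 <= u x <= L) /\
    forall z x, Y (z, x) * u x <= L * u z.
Proof.
move=> gp gc.
have L0 : 0 < L by apply: lt_le_trans L1.
pose g x s := (\prod_(e <- edges x s) Y e) / L ^+ size s.
(* A simple path has fewer than [#|V|] steps. *)
pose ws := flatten [seq words V k | k <- iota 0 #|V|].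
pose u x := \big[Num.max/1]_(s <- ws | uniq (x :: s)) g x s.
have g1 x : g x [::] = 1 by rewrite /g big_nil divr1.
have u_ge x s : uniq (x :: s) -> g x s <= u x.
  move=> us; apply: le_bigmax_seq => //.
  apply/flattenP; exists (words V (size s)); last by rewrite mem_words.
  apply/mapP; exists (size s) => //; rewrite mem_iota /= add0n.
  by have := max_card (mem (x :: s)); rewrite (card_uniqP us).
have u_ex x : exists2 s, uniq (x :: s) & u x = g x s.
  apply: (big_ind (fun v => exists2 s, uniq (x :: s) & v = g x s)).
  - by exists [::]; rewrite ?g1.
  - by move=> a b [s us ->] [t ut ->]; rewrite maxEle; case: ifP => _;
      [exists t|exists s].
  - by move=> s us; exists s.
exists u; split => [x|z x].
  (* The empty path gives the lower bound [1]; a path of [k] steps has [k + 1] vertices, which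
     leaves one factor [L] in the upper bound. *)
  rewrite -(g1 x) u_ge//=; have [s us ->] := u_ex x.
  by rewrite ler_pdivrMr ?exprn_gt0// -exprS gp.
have [s us ->] := u_ex x.
have [zs|zs] := boolP (z \in x :: s); last first.
  have := @u_ge z (x :: s); rewrite cons_uniq zs us => /(_ isT).
  rewrite /g /= big_cons exprS invfM => H.
  have := ler_wpM2l (ltW L0) H; apply: le_trans.
  by rewrite le_eqVlt; apply/orP; left; apply/eqP; field; rewrite ?expf_neq0 ?gt_eqF.
case/splitPl: zs us => p1 p2 lz us.
have u1 : uniq (x :: p1) by move: us; rewrite -cat_cons cat_uniq => /andP[].
have u2 : uniq (z :: p2).
  move: us; rewrite -cat_cons lastI cat_rcons cat_uniq lz.
  by case/and3P.
have := gc _ _ u1; rewrite lz => c1.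
have g_cat : g x (p1 ++ p2) = g x p1 * g z p2.
  by rewrite /g edges_cat lz big_cat size_cat exprD invfM /=; ring.
rewrite g_cat mulrA; apply: ler_pM; rewrite ?mulr_ge0 ?invr_ge0 ?exprn_ge0 ?prodr_ge0 ?(ltW L0) ?u_ge//.
by rewrite /g mulrA ler_pdivrMr ?exprn_gt0// -exprS mulrC.
Qed.

End Potential.

Section EvenPairWeight.
Variable V : finType.
Implicit Types (x a : V) (s t : seq V).

Lemma big_partition_seq (I : eqType) (J : eqType) (S : Type) (idx : S)
    (op : Monoid.com_law idx) (k : I -> J) (D : seq I) (W : seq J)
    (F : J -> I -> S) : uniq W -> (forall e, e \in D -> k e \in W) ->
  \big[op/idx]_(e <- D) F (k e) e =
  \big[op/idx]_(a <- W) \big[op/idx]_(e <- D | k e == a) F a e.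
Proof.
move=> uW kW; under [RHS]eq_bigr do rewrite big_mkcond.
rewrite exchange_big /= big_seq [RHS]big_seq; apply: eq_bigr => e /kW keW.
rewrite (bigD1_seq (k e))//= eqxx big1 ?Monoid.mulm1// => a /negbTE.
by rewrite eq_sym => ->.
Qed.

(** Conservation of flow at [a], up to the two endpoints of the walk. *)
Lemma edges_out_in x s a :
  (count (fun e => e.1 == a) (edges x s) + (last x s == a) = count_mem a (x :: s))%N /\
  (count (fun e => e.2 == a) (edges x s) + (x == a) = count_mem a (x :: s))%N.
Proof.
elim: s x => [|y s IH] x //=; first by rewrite addn0.
by have [] := IH y; rewrite /=; lia.
Qed.

Section Weight.
Variables (R : realType) (b : V * V -> R) (L : R) (u : V -> R).
Hypotheses (b0 : forall e, 0 <= b e) (L1 : 1 <= L).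
Hypotheses (u1 : forall x, 1 <= u x <= L).
Hypothesis bu : forall z x, b (z, x) ^+ 2 * u x <= L * u z.

(* Of the [n] uses of a step, two are kept and the remaining [n - 2] are
   estimated by the potential, whose telescoping leaves at each vertex only
   the steps of the support entering it. *)
Lemma even_pair_weight x s t :
  size s = size t -> last x s = last x t -> even_pair x s t ->
  \prod_(e <- edges x s ++ edges x t) b e <=
  L ^+ ((size s).+1 - size (undup (x :: s ++ x :: t))) *
  \prod_(e <- undup (edges x s ++ edges x t)) b e ^+ 2.
Proof.
move=> sz lst ev; set E := edges x s ++ _; set D := undup E; set W := undup _.
have uD : uniq D := undup_uniq _.
have uW : uniq W := undup_uniq _.
pose h e := (count_mem e E)./2.
have hE e : e \in D -> count_mem e E = (2 * h e)%N.
  rewrite mem_undup => eE; move/allP: ev => /(_ e eE).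
  by rewrite -/E /h => ev; rewrite mul2n -[LHS]odd_double_half (negbTE ev).
have h1 e : e \in D -> (0 < h e)%N.
  by move=> eD; have := hE _ eD; move: eD; rewrite mem_undup -has_pred1 has_count; lia.
have sumE (f : V * V -> nat) : (\sum_(e <- E) f e = \sum_(e <- D) 2 * (h e * f e))%N.
  rewrite -big_undup_iterop_count /= -/D big_seq [RHS]big_seq; apply: eq_bigr => e eD.
  by rewrite Monoid.iteropE iter_addn_0 hE// mulnC mulnA.
have WE y : (y \in W) = (y \in x :: s) || (y \in x :: t).
  by rewrite mem_undup -cat_cons mem_cat.
have DW e : e \in D -> (e.1 \in W) && (e.2 \in W).
  rewrite mem_undup mem_cat !WE => /orP[] /edges_mem /andP[-> e2].
    by rewrite [_ \in x :: s]inE e2 !orbT.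
  by rewrite [_ \in x :: t]inE e2 !orbT.
have D1 e : e \in D -> e.1 \in W by move/DW/andP => [].
have D2 e : e \in D -> e.2 \in W by move/DW/andP => [].
(* One square is kept for each step of the support; [r e] squares are left to the potential. *)
pose r e := (h e).-1.
pose o (f : V * V -> nat) a := (\sum_(e <- D | e.1 == a) f e)%N.
pose i (f : V * V -> nat) a := (\sum_(e <- D | e.2 == a) f e)%N.
have cE (P : pred (V * V)) : (count P E = 2 * \sum_(e <- D | P e) h e)%N.
  rewrite -sum1_count big_mkcond sumE -big_distrr /=; congr muln.
  rewrite [RHS]big_mkcond; apply: eq_bigr => e _.
  by case: (P e); rewrite ?muln1 ?muln0.
have outs a : (2 * (o h a + (last x t == a)) = count_mem a (x :: s) + count_mem a (x :: t))%N.
  have cO : count (fun e => e.1 == a) E = (2 * o h a)%N := cE _.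
  have [[so _] [to _]] := (edges_out_in x s a, edges_out_in x t a).
  by move: cO so to; rewrite count_cat lst; lia.
have ins a : (2 * (i h a + (x == a)) = count_mem a (x :: s) + count_mem a (x :: t))%N.
  have cI : count (fun e => e.2 == a) E = (2 * i h a)%N := cE _.
  have [[_ si] [_ ti]] := (edges_out_in x s a, edges_out_in x t a).
  by move: cI si ti; rewrite count_cat; lia.
have pos a : a \in W -> (0 < count_mem a (x :: s) + count_mem a (x :: t))%N.
  by rewrite mem_undup -cat_cons mem_cat -!has_pred1 !has_count; lia.
have hr (P : pred (V * V)) : (\sum_(e <- D | P e) h e =
    \sum_(e <- D | P e) r e + \sum_(e <- D | P e) 1)%N.
  rewrite -big_split /= big_seq_cond [RHS]big_seq_cond; apply: eq_bigr => e /andP[/h1].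
  by rewrite /r; lia.
pose one (_ : V * V) := 1%N.
have oh a : o h a = (o r a + o one a)%N by rewrite /o hr.
have ih a : i h a = (i r a + i one a)%N by rewrite /i hr.
have o_pos a : (0 < o h a)%N -> (0 < o one a)%N.
  rewrite /o sum1_count -has_count; apply: contraTT => /hasPn Pn.
  by rewrite -leqNgt leqn0 big_seq_cond big1// => e /andP[/Pn/negbTE->].
have i_pos a : (0 < i h a)%N -> (0 < i one a)%N.
  rewrite /i sum1_count -has_count; apply: contraTT => /hasPn Pn.
  by rewrite -leqNgt leqn0 big_seq_cond big1// => e /andP[/Pn/negbTE->].
have i_one a : a \in W -> (0 < i one a + (x == a))%N.
  by move/pos; have := ins a; have := i_pos a; lia.
have o_one a : a \in W -> (0 < o one a + (last x t == a))%N.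
  by move/pos; have := outs a; have := o_pos a; lia.
have szE : (size E = 2 * size s)%N by rewrite size_cat !size_edges; lia.
have sumh : (\sum_(e <- D) h e = size s)%N.
  have : count predT E = (2 * \sum_(e <- D) h e)%N := cE _.
  by rewrite count_predT szE; lia.
have sumr_ : (\sum_(e <- D) r e + size D = size s)%N.
  have : (\sum_(e <- D) h e = \sum_(e <- D) r e + \sum_(e <- D) 1)%N := hr predT.
  by rewrite sumh sum1_size; lia.
have sum_i : (\sum_(a <- W) i one a = size D)%N.
  by rewrite -(big_partition_seq addn (fun _ _ => 1%N) uW D2) sum1_size.
have sum_x : (\sum_(a <- W) (x == a) = 1)%N.
  have xW : x \in W by rewrite mem_undup mem_head.
  rewrite (bigD1_seq x)//= eqxx big1// => a /negbTE.
  by rewrite eq_sym => ->.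
(* The start counts as one entry. The entries beyond the first, summed over the vertices, measure
   the excess of steps over vertices in the support. *)
have sum_d : (\sum_(a <- W) (i one a + (x == a)).-1 + size W = size D + 1)%N.
  rewrite -sum_i -sum_x -big_split -[size W]sum1_size -big_split /=.
  by rewrite big_seq [RHS]big_seq; apply: eq_bigr => a /i_one; lia.
have L0 : 0 < L by apply: lt_le_trans L1.
have u0 a : 0 < u a by apply: lt_le_trans (andP (u1 a)).1.
have prodE : \prod_(e <- E) b e =
    \prod_(e <- D) (b e ^+ 2) ^+ r e * \prod_(e <- D) b e ^+ 2.
  rewrite -big_undup_iterop_count -/D -big_split /= big_seq [RHS]big_seq.
  apply: eq_bigr => e eD; rewrite Monoid.iteropE -/(_ ^+ _).
  have -> : iter (count_mem e E) ( *%R (b e)) 1 = b e ^+ (2 * h e)%N.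
    by rewrite hE// -Monoid.iteropE.
  by rewrite exprM -exprSr; congr (_ ^+ _); rewrite /r prednK// h1.
rewrite prodE ler_wpM2r ?prodr_ge0// => [e _|]; first by rewrite exprn_ge0.
have prod_u (k : V * V -> V) : (forall e, e \in D -> k e \in W) ->
    \prod_(e <- D) u (k e) ^+ r e =
    \prod_(a <- W) u a ^+ (\sum_(e <- D | k e == a) r e)%N.
  move=> kW; rewrite (big_partition_seq *%R (fun a e => u a ^+ r e) uW kW).
  by apply: eq_bigr => a _; rewrite expr_sum.
have P2 : 0 < \prod_(e <- D) u e.2 ^+ r e by rewrite prodr_gt0// => e _; rewrite exprn_gt0.
rewrite -(ler_pM2r P2) -big_split /=.
(* By [bu], each surplus square becomes a factor [L] while [u] moves from the head of the step to
   its tail. *)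
apply: (@le_trans _ _ (\prod_(e <- D) (L * u e.1) ^+ r e)).
  apply: ler_prod => -[z y] _; rewrite -exprMn exprn_ge0 ?mulr_ge0 ?exprn_ge0 ?(ltW (u0 _))//=.
  by rewrite lerXn2r ?nnegrE ?mulr_ge0 ?exprn_ge0 ?(ltW (u0 _)) ?(ltW L0).
under eq_bigr do rewrite exprMn.
rewrite big_split /= -expr_sum !prod_u//.
have -> : ((size s).+1 - size W = \sum_(e <- D) r e + \sum_(a <- W) (i one a + (x == a)).-1)%N.
  by lia.
rewrite exprD -mulrA ler_pM2l ?exprn_gt0// expr_sum -big_split /=.
rewrite big_seq [leRHS]big_seq; apply: ler_prod => a aW.
rewrite exprn_ge0 ?(ltW (u0 _))//= -/(o r a) -/(i r a).
(* Flow conservation for [h]: since the support leaves [a] at least once, or the walks end there,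
   surplus exits exceed surplus entries by at most the extra entries of the support. *)
have bal : (o r a <= (i one a + (x == a)).-1 + i r a)%N.
  by have := outs a; rewrite -ins oh ih; have := i_one a aW; have := o_one a aW; lia.
have [le_oi|lt_io] := leqP (o r a) (i r a).
  rewrite -[leLHS]mul1r ler_pM ?exprn_ge0 ?(ltW (u0 _))//; first exact: exprn_ege1.
  by apply: ler_weXn2l => //; case/andP: (u1 a).
rewrite -(subnK (ltnW lt_io)) exprD ler_wpM2r ?exprn_ge0 ?(ltW (u0 _))//.
apply: (@le_trans _ _ (L ^+ (o r a - i r a))).
  by rewrite lerXn2r ?nnegrE ?(ltW (u0 _)) ?(ltW L0)//; case/andP: (u1 a).
by apply: ler_weXn2l => //; rewrite leq_subLR addnC.
Qed.

End Weight.
End EvenPairWeight.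

(** For each vertex missing from [m + 1], the factor [L <= #|V| * c ^+ 4] pays for the four counted
    steps it allows; the one further counted step costs [c^-1]. With [c = n ^- 2], the total weight
    of the words of length [n] is at most [(1 + 1 / n) ^ (n - 1)], which is below [e]. *)
Lemma even_pair_sum (V : finType) (R : realType) (m : nat) (L : R) :
  (0 < #|V|)%N -> 0 <= L -> L * (2 * m.+1)%:R ^+ 8 <= #|V|%:R ->
  \sum_(x : V) \sum_(s <- words V m) \sum_(t <- words V m)
    ((last x s == last x t) && even_pair x s t)%:R *
    L ^+ (m.+1 - size (undup (x :: s ++ x :: t))) <=
  expR 1 * (2 * m.+1)%:R ^+ 2 * #|V|%:R ^+ m.+1.
Proof.
move=> V0 L0; set n := (2 * m.+1)%N => Ln.
have N0 : 0 < #|V|%:R :> R by rewrite ltr0n.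
have n0 : 0 < n%:R :> R by rewrite ltr0n.
pose q : R := #|V|%:R^-1; pose c : R := n%:R ^- 2.
have q0 : 0 <= q by rewrite invr_ge0 ltW.
have c0 : 0 < c by rewrite invr_gt0 exprn_gt0.
have c1 : c <= 1 by rewrite invf_le1 ?exprn_gt0// exprn_ege1// ler1n.
have qV : q * #|V|%:R <= 1 by rewrite mulVf// gt_eqF.
pose wt (w : seq V) : R := q ^+ size (undup w) * c ^+ (bad1 w + bad2 w).
have wt0 (w : seq V) : 0 <= wt w by rewrite mulr_ge0 ?exprn_ge0// ltW.
have L_le : L <= #|V|%:R * c ^+ 4.
  by rewrite /c -exprVn -exprM exprVn ler_pdivlMr// exprn_gt0.
have term (x : V) s t : s \in words V m -> t \in words V m ->
    ((last x s == last x t) && even_pair x s t)%:R *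
    L ^+ (m.+1 - size (undup (x :: s ++ x :: t))) <=
    c^-1 * #|V|%:R ^+ m.+1 * wt (x :: s ++ x :: t).
  rewrite !mem_words => /eqP ss /eqP st.
  set w := x :: s ++ x :: t.
  have [/andP[/eqP lst ev]|_] := boolP (_ && _); last first.
    by rewrite mul0r !mulr_ge0 ?exprn_ge0// ?invr_ge0 ?(ltW c0) ?(ltW N0).
  have [] := even_pair_excess (etrans ss (esym st)) lst ev.
  rewrite -/w ss; set v := size _ => exc vm; rewrite mul1r.
  apply: (@le_trans _ _ ((#|V|%:R * c ^+ 4) ^+ (m.+1 - v))).
    by rewrite lerXn2r// nnegrE mulr_ge0 ?exprn_ge0// ltW.
  rewrite exprMn -exprM /wt -/v.
  have -> : #|V|%:R ^+ (m.+1 - v) = #|V|%:R ^+ m.+1 * q ^+ v :> R.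
    by rewrite exprVn expfB_cond ?gt_eqF.
  rewrite [leRHS](_ : _ = #|V|%:R ^+ m.+1 * q ^+ v * (c^-1 * c ^+ (bad1 w + bad2 w))).
    2: by ring.
  rewrite ler_wpM2l ?mulr_ge0 ?exprn_ge0// ?(ltW N0)// ler_pdivlMl//.
  by rewrite -exprS ler_wiXn2l// ?(ltW c0)//; lia.
apply: (@le_trans _ _ (c^-1 * #|V|%:R ^+ m.+1 * \sum_(w <- words V (m.+1 + m.+1)) wt w)).
  rewrite big_words_cat big_wordsS mulr_sumr; apply: ler_sum => x _.
  rewrite mulr_sumr [leLHS]big_seq [leRHS]big_seq; apply: ler_sum => s ms.
  (* The pairs are the words whose second half starts again at [x]; the other words have nonnegative
     weight. *)
  rewrite big_wordsS (bigD1 x)//= mulrDr.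
  apply: (@le_trans _ _ (c^-1 * #|V|%:R ^+ m.+1 * \sum_(t <- words V m) wt (x :: s ++ x :: t))).
    rewrite mulr_sumr [leLHS]big_seq [leRHS]big_seq; apply: ler_sum => t mt.
    exact: term.
  rewrite lerDl !mulr_ge0 ?exprn_ge0// ?invr_ge0 ?(ltW c0)// ?(ltW N0)//.
  by apply: sumr_ge0 => y _; apply: sumr_ge0.
have -> : c^-1 = n%:R ^+ 2 by rewrite /c invrK.
rewrite [leRHS](_ : _ = n%:R ^+ 2 * #|V|%:R ^+ m.+1 * expR 1); last by ring.
rewrite ler_wpM2l ?mulr_ge0 ?exprn_ge0// ?(ltW N0)//.
have -> : (m.+1 + m.+1 = n.-1.+1)%N by rewrite /n; lia.
apply: (le_trans (excess_weight_sum q0 (ltW c0) qV _)).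
have -> : (n.-1.+1 = n)%N by rewrite /n; lia.
have -> : n%:R * c = n%:R^-1 by rewrite /c -exprVn expr2 mulrA divff ?mul1r// gt_eqF.
apply: (@le_trans _ _ ((expR n%:R^-1) ^+ n)).
  apply: (@le_trans _ _ ((expR n%:R^-1) ^+ n.-1)).
    by rewrite lerXn2r ?nnegrE ?expR_ge0 ?expR_ge1Dx// addr_ge0// invr_ge0 ltW.
  apply: ler_weXn2l; last exact: leq_pred.
  by rewrite -expR0 ler_expR invr_ge0.
by rewrite -expRM_natl mulfV// gt_eqF.
Qed.

(** * Random signs and the entries of matrix powers *)

Section SignedPowers.
Variables (R : realType) (N : nat).
Local Notation V := 'I_N.
Implicit Types (a : V * V -> R[i]).

Definition flip (sg : {ffun V * V -> bool}) a (e : V * V) : R[i] :=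
  (-1) ^+ sg e * a e.

Definition mx_of a : 'M[R[i]]_N := \matrix_(i, j) a (i, j).

Lemma mx_of_exprE a m i j :
  (mx_of a ^+ m) i j =
  \sum_(s <- words V m) (last i s == j)%:R * \prod_(e <- edges i s) a e.
Proof.
elim: m i => [|m IH] i.
  by rewrite expr0 big_words0 big_nil mulr1 mxE.
rewrite exprS mxE big_wordsS; apply: eq_bigr => k _.
rewrite IH mxE mulr_sumr; apply: eq_bigr => s _ /=.
by rewrite big_cons mulrCA.
Qed.

Lemma prod_flip sg a (s : seq (V * V)) :
  \prod_(e <- s) flip sg a e = \prod_(e <- s) (-1) ^+ sg e * \prod_(e <- s) a e.
Proof. by rewrite -big_split. Qed.

Lemma prod_count_mem (C : comPzSemiRingType) (I : finType) (f : I -> C) (E : seq I) :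
  \prod_(e <- E) f e = \prod_e f e ^+ count_mem e E.
Proof.
elim: E => [|x E IH]; first by rewrite big_nil big1.
under [RHS]eq_bigr do rewrite /= exprD.
rewrite big_cons IH big_split /=; congr (_ * _).
rewrite (bigD1 x)//= eqxx expr1 big1 ?mulr1// => e /negbTE.
by rewrite eq_sym => ->.
Qed.

(** The average factors over the entries, and an entry of odd multiplicity contributes
    [-1 + 1 = 0]. *)
Lemma sum_signs (E : seq (V * V)) :
  \sum_(sg : {ffun V * V -> bool}) \prod_(e <- E) (-1) ^+ sg e =
  #|{ffun V * V -> bool}|%:R * (all (fun e => ~~ odd (count_mem e E)) E)%:R :> R[i].
Proof.
under eq_bigr do rewrite prod_count_mem.
have [ev|/allPn[e eE]] := boolP (all _ _).
  rewrite mulr1 -sum1_card natr_sum; apply: eq_bigr => sg _.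
  rewrite big1// => e _; rewrite -exprM mulnC exprM -signr_odd.
  have [eE|/count_memPn->] := boolP (e \in E); last by rewrite expr1n.
  by move/allP: ev => /(_ e eE)/negbTE->; rewrite expr1n.
rewrite negbK => odd_e; rewrite mulr0.
rewrite -(bigA_distr_bigA (fun e (b : bool) => ((-1) ^+ b) ^+ count_mem e E)) /=.
rewrite (bigD1 e)//= big_bool /= expr1 expr0 expr1n -signr_odd odd_e expr1.
by rewrite addNr mul0r.
Qed.

Lemma normcM (x y : R[i]) : normc (x * y) = normc x * normc y.
Proof. exact: ComplexField.Normc.normcM. Qed.

Lemma norm_complexE (z : R[i]) : `|z| = (normc z)%:C%C.
Proof. by case: z. Qed.

(** The squared modulus expands into pairs of walks from [i] to [j]. Moduli are taken only after the
    signs have cancelled the pairs that are not even. *)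
Lemma sum_flip_normc_sqr a m i j :
  \sum_sg normc ((mx_of (flip sg a) ^+ m) i j) ^+ 2 <=
  #|{ffun V * V -> bool}|%:R *
  \sum_(s <- words V m) \sum_(t <- words V m)
    ((last i s == j) && (last i t == j) && even_pair i s t)%:R *
    \prod_(e <- edges i s ++ edges i t) normc (a e).
Proof.
pose K : R[i] := #|{ffun V * V -> bool}|%:R.
pose I s t : R[i] := ((last i s == j) && (last i t == j) && even_pair i s t)%:R.
have key : (\sum_sg normc ((mx_of (flip sg a) ^+ m) i j) ^+ 2)%:C%C =
    K * \sum_(s <- words V m) \sum_(t <- words V m)
      I s t * (\prod_(e <- edges i s) a e * (\prod_(e <- edges i t) a e)^*%R).
  rewrite rmorph_sum /=.
  transitivity (\sum_(sg : {ffun V * V -> bool})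
      \sum_(s <- words V m) \sum_(t <- words V m)
      (\prod_(e <- edges i s ++ edges i t) (-1) ^+ sg e) *
      (((last i s == j) && (last i t == j))%:R *
       (\prod_(e <- edges i s) a e * (\prod_(e <- edges i t) a e)^*%R))).
    apply: eq_bigr => sg _.
    rewrite rmorphXn /= -norm_complexE normCK mx_of_exprE rmorph_sum big_distrlr /=.
    apply: eq_bigr => s _; apply: eq_bigr => t _.
    rewrite !prod_flip !rmorphM /= rmorph_nat big_cat /=.
    rewrite [X in _ * (_ * (X * _))](_ : _ = \prod_(e <- edges i t) (-1) ^+ sg e).
      2: by rewrite rmorph_prod; apply: eq_bigr => e _; rewrite rmorph_sign.
    by rewrite -mulnb natrM; ring.
  rewrite exchange_big mulr_sumr /=; apply: eq_bigr => s _.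
  rewrite exchange_big mulr_sumr /=; apply: eq_bigr => t _.
  rewrite -mulr_suml sum_signs -/(even_pair i s t) /I -!mulnb !natrM /K.
  by ring.
rewrite -lecR -[leLHS]ger0_norm; last by rewrite lecR sumr_ge0// => sg _; rewrite exprn_ge0// /normc; case: (_ i j) => ? ?; rewrite sqrtr_ge0.
rewrite key normrM rmorphM /= {1}/K normr_nat rmorph_nat ler_wpM2l//.
rewrite (le_trans (ler_norm_sum _ _ _))// rmorph_sum; apply: ler_sum => s _.
rewrite (le_trans (ler_norm_sum _ _ _))// rmorph_sum; apply: ler_sum => t _.
rewrite !normrM /I normr_nat norm_conjC !normr_prod rmorphM rmorph_nat ler_wpM2l//=.
rewrite rmorph_prod big_cat /= le_eqVlt; apply/orP; left; apply/eqP.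
by congr (_ * _); apply: eq_bigr => e _; rewrite norm_complexE.
Qed.

End SignedPowers.

(** * Spectral radius and matrix powers *)

Section SpectralRadius.
Variables (R : realType) (N : nat).
Implicit Types (A : 'M[R[i]]_N).

Lemma normc_ge0 (z : R[i]) : 0 <= normc z.
Proof. by case: z => x y; rewrite sqrtr_ge0. Qed.

Lemma normcX (z : R[i]) n : normc (z ^+ n) = normc z ^+ n.
Proof. by apply: complexI; rewrite rmorphXn /= -!norm_complexE normrX. Qed.

Lemma normcD (x y : R[i]) : normc (x + y) <= normc x + normc y.
Proof. by rewrite -lecR rmorphD /= -!norm_complexE ler_normD. Qed.

Lemma normc_sum (I : Type) (r : seq I) (P : pred I) (F : I -> R[i]) :
  normc (\sum_(i <- r | P i) F i) <= \sum_(i <- r | P i) normc (F i).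
Proof.
by rewrite -lecR rmorph_sum /= -norm_complexE (le_trans (ler_norm_sum _ _ _)).
Qed.

Definition sum_normc A : R := \sum_i \sum_j normc (A i j).

Lemma sum_normc_ge0 A : 0 <= sum_normc A.
Proof. by apply: sumr_ge0 => i _; apply: sumr_ge0 => j _; rewrite normc_ge0. Qed.

(** A left eigenvector is compared with its image under [A ^+ m] at a coordinate of largest
    modulus. *)
Lemma eigenvalue_expr_le A l m : eigenvalue A l -> normc l ^+ m <= sum_normc (A ^+ m).
Proof.
move=> /eigenvalueP[v vA v0].
have vAm : v *m A ^+ m = l ^+ m *: v.
  elim: m => [|m IH]; first by rewrite !expr0 mulmx1 scale1r.
  by rewrite exprSr mulmxA IH -scalemxAl vA scalerA exprSr.
have [k0 vk0] : exists k, v 0 k != 0.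
  by apply/rV0Pn.
have [k _ kmax] := @arg_maxP _ R _ k0 predT (fun k => normc (v 0 k)) isT.
have vk : 0 < normc (v 0 k).
  apply: lt_le_trans (kmax k0 isT); rewrite lt_def normc_ge0 andbT.
  by apply: contraNneq vk0 => /ComplexField.Normc.eq0_normc ->.
rewrite -(ler_pM2r vk) -normcX -normcM.
have -> : l ^+ m * v 0 k = \sum_i v 0 i * (A ^+ m) i k.
  by have /matrixP/(_ 0 k) := vAm; rewrite !mxE => ->.
rewrite (le_trans (normc_sum _ _ _))// /sum_normc mulr_suml; apply: ler_sum => i _.
rewrite normcM mulrC ler_pM ?normc_ge0//; last exact: kmax.
by rewrite (bigD1 k)//= lerDl sumr_ge0// => j _; rewrite normc_ge0.
Qed.

Lemma spectral_radius_expr_le A t m : (0 < N)%N -> 0 <= t ->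
  t <= spectral_radius A -> t ^+ m <= sum_normc (A ^+ m).
Proof.
move=> N0 t0 tA; have [[l lA lE] _] := spectral_radius_max A N0.
apply: le_trans (eigenvalue_expr_le m lA).
by rewrite lerXn2r ?nnegrE ?normc_ge0// lE.
Qed.

(** Cauchy-Schwarz over the [N ^ 2] entries. *)
Lemma sum_normc_sqr A :
  sum_normc A ^+ 2 <= N%:R ^+ 2 * \sum_i \sum_j normc (A i j) ^+ 2.
Proof.
rewrite /sum_normc !pair_big /=; set F := fun p : 'I_N * 'I_N => normc (A p.1 p.2).
have -> : N%:R ^+ 2 = #|{: 'I_N * 'I_N}|%:R :> R.
  by rewrite card_prod card_ord natrM expr2.
have amgm (x y : R) : x * y <= (x ^+ 2 + y ^+ 2) / 2.
  rewrite ler_pdivlMr// -subr_ge0.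
  by rewrite [leRHS](_ : _ = (x - y) ^+ 2) ?sqr_ge0//; ring.
rewrite expr2 mulr_suml.
apply: (@le_trans _ _ (\sum_p \sum_q (F p ^+ 2 + F q ^+ 2) / 2)).
  by apply: ler_sum => p _; rewrite mulr_sumr; apply: ler_sum => q _; apply: amgm.
set S := (X in _ <= _ * X); set K := #|_|.
rewrite (eq_bigr (fun p => (F p ^+ 2 *+ K + S) / 2)) => [|p _].
  rewrite -mulr_suml big_split /= sumr_const sumrMnl -/S -/K -mulr_natl.
  by rewrite le_eqVlt; apply/orP; left; apply/eqP; field.
by rewrite -mulr_suml big_split /= sumr_const.
Qed.

Lemma spectral_radius_sqr_le A t m : (0 < N)%N -> 0 <= t ->
  t <= spectral_radius A ->
  t ^+ (2 * m) <= N%:R ^+ 2 * \sum_i \sum_j normc ((A ^+ m) i j) ^+ 2.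
Proof.
move=> N0 t0 tA; rewrite (le_trans _ (sum_normc_sqr _))// mulnC exprM.
rewrite lerXn2r ?nnegrE ?exprn_ge0 ?sum_normc_ge0//.
exact: spectral_radius_expr_le.
Qed.

Lemma sum_normcD A B : sum_normc (A + B) <= sum_normc A + sum_normc B.
Proof.
rewrite /sum_normc -big_split; apply: ler_sum => i _ /=.
by rewrite -big_split; apply: ler_sum => j _; rewrite mxE normcD.
Qed.

Lemma sum_normcZ (l : R[i]) A : sum_normc (l *: A) = normc l * sum_normc A.
Proof.
rewrite /sum_normc mulr_sumr; apply: eq_bigr => i _.
by rewrite mulr_sumr; apply: eq_bigr => j _; rewrite mxE normcM.
Qed.

End SpectralRadius.

Lemma exists_expr_ge (R : realType) (q M : R) : 1 < q -> exists2 k, (0 < k)%N & M <= q ^+ k.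
Proof.
move=> q1.
have bern k : 1 + k%:R * (q - 1) <= q ^+ k.
  elim: k => [|k IHk]; first by rewrite mul0r addr0.
  rewrite exprS; apply: le_trans (ler_wpM2l (ltW (lt_trans ltr01 q1)) IHk).
  have : 0 <= k%:R * (q - 1) ^+ 2 by rewrite mulr_ge0// sqr_ge0.
  rewrite -natr1; move: (k%:R) => z; nra.
exists (Num.truncn (M / (q - 1))).+1 => //.
apply: le_trans (bern _); apply: ltW.
have q0 : 0 < q - 1 by rewrite subr_gt0.
apply: (@lt_trans _ _ ((Num.truncn (M / (q - 1))).+1%:R * (q - 1))).
  by rewrite -ltr_pdivrMr// truncnS_gt.
by rewrite ltrDr.
Qed.

(** * A Gelfand-type bound on the growth of powers *)

Section Gelfand.
Variables (R : realType) (n : nat).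
Implicit Types (A C : 'M[R[i]]_n.+1).

(** The roots are peeled off one at a time: [C * A ^+ k.+1] is [l] times [C * A ^+ k] plus
    [C * (A - l%:M) * A ^+ k], to which the induction on [rs] applies. *)
Lemma annihilated_growth A C (q : R) (rs : seq R[i]) : 0 < q ->
  (forall l, l \in rs -> normc l < q) ->
  C * \prod_(l <- rs) (A - l%:M) = 0 ->
  exists K, forall k, sum_normc (C * A ^+ k) <= K * q ^+ k.
Proof.
move=> q0; elim: rs C => [|l rs IH] C lq.
  rewrite big_nil mulr1 => ->; exists 0 => k.
  by rewrite mul0r mul0r /sum_normc big1// => i _; rewrite big1// => j _; rewrite mxE ComplexField.Normc.normc0.
rewrite big_cons mulrA => C0.
have [||K' K'P] := IH (C * (A - l%:M)) => //.
  by move=> z zr; rewrite lq// inE zr orbT.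
have lq' : 0 < q - normc l by rewrite subr_gt0 lq ?mem_head.
(* The first bound starts the recursion; the second, [K' <= K * (q - normc l)], closes it at rate
   [q]. *)
pose K := Num.max (sum_normc C) (K' / (q - normc l)); exists K.
elim=> [|k IHk]; first by rewrite !expr0 !mulr1 le_max lexx.
have -> : C * A ^+ k.+1 = l *: (C * A ^+ k) + C * (A - l%:M) * A ^+ k.
  rewrite exprS mulrBr mulrBl mulrA -[_ * l%:M]/(C *m l%:M) mul_mx_scalar.
  by rewrite -scalerAl addrC subrK.
rewrite (le_trans (sum_normcD _ _))// sum_normcZ.
apply: (@le_trans _ _ (normc l * (K * q ^+ k) + K * (q - normc l) * q ^+ k)).
  rewrite lerD ?ler_wpM2l ?normc_ge0// (le_trans (K'P k))//.
  by rewrite ler_wpM2r ?exprn_ge0 ?(ltW q0)// -ler_pdivrMr// le_max lexx orbT.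
by rewrite exprS le_eqVlt; apply/orP; left; apply/eqP; ring.
Qed.

(** If the spectral radius were below [t], then for [q] strictly between them Cayley-Hamilton and
    [annihilated_growth] would bound the powers by [K * q ^+ k], which [t ^+ k] eventually exceeds.
    This converse serves to express the tail event by powers. *)
Lemma spectral_radius_ge A (t : R) : 0 < t ->
  (forall k, t ^+ k <= sum_normc (A ^+ k)) -> t <= spectral_radius A.
Proof.
move=> t0 tA; rewrite leNgt; apply/negP => rt.
have [[l0 l0A l0E] rmax] := spectral_radius_max A (ltn0Sn n).
have r0 : 0 <= spectral_radius A by rewrite -l0E normc_ge0.
set r := spectral_radius A in rt rmax r0.
pose q := (r + t) / 2.
have q0 : 0 < q by rewrite divr_gt0// ltr_wpDl.
have rq : r < q by rewrite /q; lra.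
have qt : q < t by rewrite /q; lra.
have [rs def] := closed_field_poly_normal (char_poly A).
rewrite (monicP (char_poly_monic A)) scale1r in def.
have [l||K KP] := @annihilated_growth A 1 q rs q0.
- rewrite -root_prod_XsubC -def -eigenvalue_root_char => /rmax.
  by move/le_lt_trans; apply.
- have := Cayley_Hamilton A; rewrite def rmorph_prod /= mul1r => <-.
  by apply: eq_bigr => l _; rewrite rmorphB /= horner_mx_X horner_mx_C.
have tq : 1 < t / q by rewrite ltr_pdivlMr// mul1r.
have [k _ kP] := exists_expr_ge (K + 1) tq.
have : (t / q) ^+ k <= K.
  rewrite expr_div_n ler_pdivrMr ?exprn_gt0//.
  by apply: le_trans (tA k) _; have := KP k; rewrite mul1r.
by move/(le_trans kP); rewrite leNgt ltrDl ltr01.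
Qed.

End Gelfand.


(** * Averaging over sign patterns *)

Section FlipAverage.
Variables (R : realType) (N : nat) (p t L : R) (m : nat).
Hypotheses (p0 : 0 < p) (t0 : 0 < t) (L1 : 1 <= L).
Local Notation V := 'I_N.
Implicit Types (a : V * V -> R[i]).

(** An event implied by [t <= spectral_radius], and accessible to second moments. *)
Definition large_power a : bool :=
  t ^+ (2 * m) <= N%:R ^+ 2 * \sum_i \sum_j normc ((mx_of a ^+ m) i j) ^+ 2.

Definition closed_edges (x : V) s := (last x s, x) :: edges x s.

(** Markov's inequality and the union bound in one sum: some term exceeds [1] as soon as a simple
    path or cycle violates [good_paths] or [good_cycles]. *)
Definition heavy_paths a : R :=
  \sum_(k < N) \sum_(x : V) \sum_(s <- words V k | uniq (x :: s))
    (\prod_(e <- edges x s) (normc (a e) ^+ 2) `^ p +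
     \prod_(e <- closed_edges x s) (normc (a e) ^+ 2) `^ p) / (L `^ p) ^+ k.+1.

(** What Markov's inequality over the signs and [even_pair_weight] leave when all simple paths and
    cycles are good. *)
Definition light_walks a : R :=
  N%:R ^+ 2 / t ^+ (2 * m) *
  \sum_(x : V) \sum_(s <- words V m) \sum_(s' <- words V m)
    ((last x s == last x s') && even_pair x s s')%:R *
    L ^+ (m.+1 - size (undup (x :: s ++ x :: s'))) *
    \prod_(e <- undup (edges x s ++ edges x s')) normc (a e) ^+ 2.

Lemma prod_powR (I : Type) (r : seq I) (F : I -> R) : (forall i, 0 <= F i) ->
  \prod_(i <- r) F i `^ p = (\prod_(i <- r) F i) `^ p.
Proof.
move=> F0; elim: r => [|i r IH]; first by rewrite !big_nil powR1.
by rewrite !big_cons IH powRM// prodr_ge0.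
Qed.

Lemma heavy_paths_ge0 a : 0 <= heavy_paths a.
Proof.
apply: sumr_ge0 => k _; apply: sumr_ge0 => x _; apply: sumr_ge0 => s _.
by rewrite divr_ge0 ?exprn_ge0 ?powR_ge0// addr_ge0// prodr_ge0// => e _; rewrite powR_ge0.
Qed.

Lemma light_walks_ge0 a : 0 <= light_walks a.
Proof.
rewrite mulr_ge0 ?divr_ge0 ?exprn_ge0 ?(ltW t0)//.
apply: sumr_ge0 => x _; apply: sumr_ge0 => s _; apply: sumr_ge0 => s' _.
rewrite !mulr_ge0 ?exprn_ge0 ?(le_trans ler01 L1)// prodr_ge0// => e _.
by rewrite exprn_ge0 ?normc_ge0.
Qed.

Lemma heavy_paths_lt1 a : heavy_paths a < 1 ->
  good_paths (fun e => normc (a e) ^+ 2) L /\ good_cycles (fun e => normc (a e) ^+ 2) L.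
Proof.
move=> H; have L0 : 0 < L by apply: lt_le_trans L1.
pose Y e := normc (a e) ^+ 2; have Y0 e : 0 <= Y e by rewrite exprn_ge0 ?normc_ge0.
have PQ (x : V) s : uniq (x :: s) ->
    \prod_(e <- edges x s) Y e <= L ^+ (size s).+1 /\
    \prod_(e <- closed_edges x s) Y e <= L ^+ (size s).+1.
  move=> us.
  have sN : (size s < N)%N.
    by have := max_card (mem (x :: s)); rewrite (card_uniqP us) card_ord.
  pose G s := (\prod_(e <- edges x s) Y e `^ p +
     \prod_(e <- closed_edges x s) Y e `^ p) / (L `^ p) ^+ (size s).+1.
  have pr0 l : 0 <= \prod_(e <- l) Y e `^ p by apply: prodr_ge0 => e _; rewrite powR_ge0.
  have G0 s' : 0 <= G s' by rewrite divr_ge0 ?exprn_ge0 ?powR_ge0// addr_ge0.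
  have /le_lt_trans/(_ H) : G s <= heavy_paths a.
    rewrite /heavy_paths (bigD1 (Ordinal sN))//= (bigD1 x)//=.
    rewrite -addrA ler_wpDr//.
      apply: addr_ge0; apply: sumr_ge0 => y _; apply: sumr_ge0 => z _; last apply: sumr_ge0 => w _;
      by rewrite divr_ge0 ?exprn_ge0 ?powR_ge0// addr_ge0 ?pr0.
    rewrite (big_rem s) ?mem_words//= (us : (x \notin s) && uniq s) lerDl.
    by apply: sumr_ge0 => z _; rewrite divr_ge0 ?exprn_ge0 ?powR_ge0// addr_ge0 ?pr0.
  have Lk : (L `^ p) ^+ (size s).+1 = (L ^+ (size s).+1) `^ p.
    by rewrite -(powR_mulrn _ (powR_ge0 L p)) -(powR_mulrn _ (ltW L0)) powRAC.
  have Lk0 : 0 <= L ^+ (size s).+1 by rewrite exprn_ge0 ?(ltW L0).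
  have prY l : 0 <= \prod_(e <- l) Y e by apply: prodr_ge0.
  rewrite /G ltr_pdivrMr ?exprn_gt0 ?powR_gt0// mul1r Lk => GL.
  have le_prod l : \prod_(e <- l) Y e `^ p < (L ^+ (size s).+1) `^ p ->
      \prod_(e <- l) Y e <= L ^+ (size s).+1.
    rewrite prod_powR// ltNge => /negP nle; rewrite leNgt; apply/negP => /ltW le_l.
    by apply: nle; rewrite ge0_ler_powR ?nnegrE ?(ltW p0) ?prY.
  by split; apply: le_prod; apply: le_lt_trans GL; rewrite ?lerDl ?lerDr.
split=> x s /PQ[]// _.
by rewrite /closed_edges big_cons mulrC.
Qed.

(** If [heavy_paths a] reaches [1] the bound is trivial. Otherwise the potential exists, and one
    potential serves all sign patterns because it depends on moduli only. *)
Lemma sum_large_power_le a :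
  \sum_sg (large_power (flip sg a))%:R <=
  #|{ffun V * V -> bool}|%:R * (heavy_paths a + light_walks a).
Proof.
have [H1|H1] := leP 1 (heavy_paths a).
  apply: (@le_trans _ _ #|{ffun V * V -> bool}|%:R).
    rewrite -sum1_card natr_sum; apply: ler_sum => sg _.
    by rewrite ler_nat leq_b1.
  by rewrite ler_peMr// (le_trans H1)// lerDl light_walks_ge0.
have [gp gc] := heavy_paths_lt1 H1.
have Y0 e : 0 <= normc (a e) ^+ 2 by rewrite exprn_ge0 ?normc_ge0.
have [u [u1 uY]] := potential Y0 L1 gp gc.
have tm : 0 < t ^+ (2 * m) by rewrite exprn_gt0.
set K : R := #|_|%:R.
apply: (@le_trans _ _ (K * light_walks a)); last first.
  by rewrite ler_wpM2l// lerDr heavy_paths_ge0.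
pose S sg := \sum_i \sum_j normc ((mx_of (flip sg a) ^+ m) i j) ^+ 2.
(* Markov's inequality for the uniform average over sign patterns. *)
apply: (@le_trans _ _ (N%:R ^+ 2 / t ^+ (2 * m) * \sum_sg S sg)).
  rewrite mulr_sumr; apply: ler_sum => sg _; rewrite /large_power -/(S sg).
  have S0 : 0 <= S sg.
    by apply: sumr_ge0 => i _; apply: sumr_ge0 => j _; rewrite exprn_ge0 ?normc_ge0.
  have [tS|_] := leP (t ^+ (2 * m)) _; last by rewrite mulr_ge0// divr_ge0 ?exprn_ge0// ltW.
  by rewrite mulrAC ler_pdivlMr// mul1r.
rewrite /light_walks mulrCA ler_wpM2l ?divr_ge0 ?exprn_ge0 ?(ltW t0)//.
rewrite /S exchange_big mulr_sumr /=; apply: ler_sum => x _.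
rewrite exchange_big /=.
apply: (le_trans (ler_sum _ (fun j _ => sum_flip_normc_sqr a m x j))).
rewrite -mulr_sumr ler_wpM2l// exchange_big /= [leLHS]big_seq [leRHS]big_seq.
apply: ler_sum => s; rewrite mem_words => /eqP ss.
rewrite exchange_big /= [leLHS]big_seq [leRHS]big_seq.
apply: ler_sum => s'; rewrite mem_words => /eqP ss'.
rewrite -mulr_suml.
have -> : \sum_(j : V) ((last x s == j) && (last x s' == j) && even_pair x s s')%:R =
    ((last x s == last x s') && even_pair x s s')%:R :> R.
  rewrite (bigD1 (last x s))//= eqxx /= [last x s' == _]eq_sym big1 ?addr0// => j.
  by rewrite eq_sym => /negbTE->.
have [/andP[/eqP lst ev]|_] := boolP (_ && _); last by rewrite !mul0r.
rewrite !mul1r; have := @even_pair_weight V R (fun e => normc (a e)) L u (fun e => normc_ge0 _) L1 u1 uY _ _ _ (etrans ss (esym ss')) lst ev.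
by rewrite ss.
Qed.

End FlipAverage.

(** * Measurability *)

Section ComplexMeasurable.
Context d (T : measurableType d) (R : realType).
Implicit Types (f g : T -> R[i]).

Definition Re_of (z : R[i]) : R := (ReIm z).1.
Definition Im_of (z : R[i]) : R := (ReIm z).2.

Lemma measurable_ReIm : measurable_fun [set: R[i]] (@ReIm R).
Proof. by move=> _ B mB; exists B. Qed.

Lemma measurable_Re_of : measurable_fun [set: R[i]] Re_of.
Proof. exact: measurableT_comp measurable_fst measurable_ReIm. Qed.

Lemma measurable_Im_of : measurable_fun [set: R[i]] Im_of.
Proof. exact: measurableT_comp measurable_snd measurable_ReIm. Qed.

Lemma measurable_complexP f : measurable_fun setT f <->
  measurable_fun setT (Re_of \o f) /\ measurable_fun setT (Im_of \o f).
Proof.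
split=> [mf|[mr mi]].
  by split; [exact: measurableT_comp measurable_Re_of mf
            |exact: measurableT_comp measurable_Im_of mf].
move=> _ _ [B mB <-]; rewrite !setTI.
have := measurable_fun_pair mr mi; move=> /(_ measurableT B mB).
rewrite setTI; congr measurable.
by apply/seteqP; split => w /=; rewrite /Re_of /Im_of; case: (ReIm _).
Qed.

Lemma measurable_complexD f g : measurable_fun setT f -> measurable_fun setT g ->
  measurable_fun setT (fun w => f w + g w).
Proof.
move=> /measurable_complexP[f1 f2] /measurable_complexP[g1 g2].
apply/measurable_complexP; split.
  rewrite (_ : _ \o _ = (Re_of \o f) \+ (Re_of \o g)); first exact: measurable_funD.
  by apply/funext => w /=; case: (f w) (g w) => [? ?] [? ?].
rewrite (_ : _ \o _ = (Im_of \o f) \+ (Im_of \o g)); first exact: measurable_funD.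
by apply/funext => w /=; case: (f w) (g w) => [? ?] [? ?].
Qed.

Lemma measurable_complexM f g : measurable_fun setT f -> measurable_fun setT g ->
  measurable_fun setT (fun w => f w * g w).
Proof.
move=> /measurable_complexP[f1 f2] /measurable_complexP[g1 g2].
apply/measurable_complexP; split.
  rewrite (_ : _ \o _ = ((Re_of \o f) \* (Re_of \o g)) \- ((Im_of \o f) \* (Im_of \o g))).
    by apply: measurable_funB; apply: measurable_funM.
  by apply/funext => w /=; case: (f w) (g w) => [? ?] [? ?].
rewrite (_ : _ \o _ = ((Re_of \o f) \* (Im_of \o g)) \+ ((Im_of \o f) \* (Re_of \o g))).
  by apply: measurable_funD; apply: measurable_funM.
by apply/funext => w /=; case: (f w) (g w) => [? ?] [? ?].
Qed.

Lemma measurable_complex_sum (I : Type) (r : seq I) (F : I -> T -> R[i]) :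
  (forall i, measurable_fun setT (F i)) ->
  measurable_fun setT (fun w => \sum_(i <- r) F i w).
Proof.
move=> mF; elim: r => [|i r IH].
  by under eq_fun do rewrite big_nil; exact: measurable_cst.
by under eq_fun do rewrite big_cons; exact: measurable_complexD.
Qed.

Lemma measurable_matrix_expr N (A : T -> 'M[R[i]]_N) k :
  (forall i j, measurable_fun setT (fun w => A w i j)) ->
  forall i j, measurable_fun setT (fun w => (A w ^+ k) i j).
Proof.
move=> mA; elim: k => [|k IH] i j.
  by under eq_fun do rewrite expr0; exact: measurable_cst.
under eq_fun do rewrite exprS mxE.
by apply: measurable_complex_sum => l; apply: measurable_complexM.
Qed.

End ComplexMeasurable.

Lemma measurable_normc (R : realType) : measurable_fun [set: R[i]] (@normc R).
Proof.
rewrite (_ : @normc R = Num.sqrt \o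
    (((fun x => x ^+ 2) \o @Re_of R) \+ ((fun x => x ^+ 2) \o @Im_of R))).
  apply: measurableT_comp; first exact: continuous_measurable_fun (@sqrt_continuous R).
  by apply: measurable_funD; apply: measurable_funX;
     [exact: measurable_Re_of|exact: measurable_Im_of].
by apply/funext => -[].
Qed.

Section MatrixMeasurable.
Context d (T : measurableType d) (R : realType) (N : nat).
Variable A : T -> 'M[R[i]]_N.
Hypothesis mA : forall i j, measurable_fun setT (fun w => A w i j).

Lemma measurable_entry_normc k i j :
  measurable_fun setT (fun w => normc ((A w ^+ k) i j)).
Proof. exact: measurableT_comp (@measurable_normc R) (measurable_matrix_expr k mA i j). Qed.

Lemma measurable_sum_normc k : measurable_fun setT (fun w => sum_normc (A w ^+ k)).
Proof.
apply: measurable_sum => i; apply: measurable_sum => j.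
exact: measurable_entry_normc.
Qed.

Lemma measurable_sum_normc_sqr k : measurable_fun setT
  (fun w => N%:R ^+ 2 * \sum_i \sum_j normc ((A w ^+ k) i j) ^+ 2).
Proof.
apply: measurable_funM; first exact: measurable_cst.
apply: measurable_sum => i; apply: measurable_sum => j; apply: measurable_funX.
exact: measurable_entry_normc.
Qed.

Lemma measurable_ge_cst (f : T -> R) c : measurable_fun setT f ->
  measurable [set w | c <= f w].
Proof.
move=> mf; have := mf measurableT `[c, +oo[%classic (measurable_itv _).
by rewrite setTI; congr measurable; apply/seteqP; split => w /=; rewrite in_itv /= andbT.
Qed.

(** [spectral_radius_expr_le] and [spectral_radius_ge] make the event a countable intersection of
    conditions on the entries of powers. *)
Lemma measurable_spectral_radius_ge t : (0 < N)%N -> 0 < t ->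
  measurable [set w | t <= spectral_radius (A w)].
Proof.
move=> N0 t0.
have -> : [set w | t <= spectral_radius (A w)] =
    \bigcap_k [set w | t ^+ k <= sum_normc (A w ^+ k)].
  apply/seteqP; split => w /= tw.
    by move=> k _; apply: spectral_radius_expr_le => //; exact: ltW.
  have ge n (B : 'M[R[i]]_n) : (0 < n)%N ->
      (forall k, t ^+ k <= sum_normc (B ^+ k)) -> t <= spectral_radius B.
    by case: n B => // n B _; exact: spectral_radius_ge.
  by apply: ge => // k; apply: tw.
apply: bigcapT_measurable => k; apply: measurable_ge_cst.
exact: measurable_sum_normc.
Qed.

End MatrixMeasurable.

(** * Independence *)

Section IntegralFactor.
Local Open Scope ereal_scope.
Context d d' (T : measurableType d) (T' : measurableType d') (R : realType).
Variables (P : {measure set T -> \bar R}) (h : T -> R) (Z : T -> T') (c : R).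
Hypotheses (mh : measurable_fun setT h) (h0 : forall w, (0 <= h w)%R).
Hypotheses (mZ : measurable_fun setT Z) (c0 : (0 <= c)%R).
Hypothesis hZ : forall A, measurable A ->
  \int[P]_w (h w * \1_A (Z w))%:E = c%:E * P (Z @^-1` A).

Let mZ_pre A : measurable A -> measurable (Z @^-1` A).
Proof. by move=> mA; rewrite -[X in measurable X]setTI; exact: mZ. Qed.

Import HBNNSimple.

Lemma integral_factor_nnsfun (f : {nnsfun T' >-> R}) :
  \int[P]_w (h w * f (Z w))%:E = c%:E * \int[P]_w (f (Z w))%:E.
Proof.
pose r : seq R := finmap.enum_fset (fset_set (range f)).
have fE y : f y = (\sum_(k <- r) `|k| * \1_(f @^-1` [set k]) y)%R.
  rewrite {1}fimfunE fsbig_finite//= big_seq [RHS]big_seq.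
  apply: eq_bigr => k; rewrite in_fset_set// inE => -[z _ <-].
  by rewrite ger0_norm.
have mfk k : measurable (f @^-1` [set k]) by exact: measurable_funPTI.
have mi k : measurable_fun setT (fun w => \1_(f @^-1` [set k]) (Z w) : R).
  by apply: (measurableT_comp (measurable_indic _) mZ) => //; exact: mfk.
transitivity (\sum_(k <- r) \int[P]_w (`|k|%:E * (h w * \1_(f @^-1` [set k]) (Z w))%:E)).
  rewrite -ge0_integral_sum//; last 2 first.
  - move=> k; apply/measurable_EFinP/measurable_funM; first exact: measurable_cst.
    by apply: measurable_funM.
  - by move=> k w _; rewrite lee_fin !mulr_ge0.
  apply: eq_integral => w _; rewrite fE mulr_sumr -sumEFin; apply: eq_bigr => k _.
  by rewrite -EFinM mulrCA.
transitivity (\sum_(k <- r) c%:E * \int[P]_w (`|k| * \1_(f @^-1` [set k]) (Z w))%:E).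
  apply: eq_bigr => k _; rewrite ge0_integralZl//; last 2 first.
  - by apply/measurable_EFinP/measurable_funM.
  - by move=> w _; rewrite lee_fin mulr_ge0.
  under [in RHS]eq_integral do rewrite EFinM.
  rewrite ge0_integralZl//; last by apply/measurable_EFinP.
  rewrite hZ// muleCA; congr (_ * (_ * _)).
  rewrite -[in LHS](setIT (Z @^-1` _)) -integral_indic//; last exact: mZ_pre.
rewrite -ge0_sume_distrr; last first.
  by move=> k _; apply: integral_ge0 => w _; rewrite lee_fin mulr_ge0.
rewrite -ge0_integral_sum//; last first.
  by move=> k; apply/measurable_EFinP/measurable_funM => //; exact: measurable_cst.
by congr (_ * _); apply: eq_integral => w _; rewrite fE -sumEFin.
Qed.

(** From simple functions to nonnegative ones by monotone convergence on both sides. *)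
Lemma integral_factor (f : T' -> R) :
  measurable_fun setT f -> (forall y, (0 <= f y)%R) ->
  \int[P]_w (h w * f (Z w))%:E = c%:E * \int[P]_w (f (Z w))%:E.
Proof.
move=> mf f0; have mEf : measurable_fun setT (EFin \o f) by exact/measurable_EFinP.
pose F := nnsfun_approx measurableT mEf.
have Fcvg y : EFin \o F^~ y @ \oo --> (f y)%:E.
  have F0 z : [set: T'] z -> 0 <= (EFin \o f) z by rewrite lee_fin.
  exact: (@cvg_nnsfun_approx _ _ _ _ measurableT _ mEf F0 y Logic.I).
have Fnd y : {homo (fun n => F n y) : m n / (m <= n)%N >-> (m <= n)%R}.
  by move=> m n mn; exact/lefP/nd_nnsfun_approx.
have mFZ n : measurable_fun setT (fun w => F n (Z w)) by exact: measurableT_comp mZ.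
have lim1 : \int[P]_w (h w * F n (Z w))%:E @[n --> \oo] --> \int[P]_w (h w * f (Z w))%:E.
  have -> : \int[P]_w (h w * f (Z w))%:E =
      \int[P]_w limn (fun n => (h w * F n (Z w))%:E).
    apply: eq_integral => w _; apply/esym/cvg_lim => //.
    under eq_fun do rewrite EFinM.
    by rewrite EFinM; apply: cvgeZl => //; exact: Fcvg.
  apply: (@cvg_monotone_convergence _ _ _ P setT measurableT
     (fun n w => (h w * F n (Z w))%:E)).
  - by move=> n; apply/measurable_EFinP/measurable_funM.
  - by move=> n w _; rewrite lee_fin mulr_ge0.
  - by move=> w _ m n mn; rewrite lee_fin ler_wpM2l// Fnd.
have lim2 : \int[P]_w (F n (Z w))%:E @[n --> \oo] --> \int[P]_w (f (Z w))%:E.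
  have -> : \int[P]_w (f (Z w))%:E = \int[P]_w limn (fun n => (F n (Z w))%:E).
    by apply: eq_integral => w _; apply/esym/cvg_lim => //; exact: Fcvg.
  apply: (@cvg_monotone_convergence _ _ _ P setT measurableT
     (fun n w => (F n (Z w))%:E)).
  - by move=> n; apply/measurable_EFinP.
  - by move=> n w _; rewrite lee_fin.
  - by move=> w _ m n mn; rewrite lee_fin Fnd.
apply: (cvg_unique _ lim1) => //.
rewrite (_ : (fun n => _) = fun n => c%:E * \int[P]_w (F n (Z w))%:E); last first.
  by apply/funext => n; exact: integral_factor_nnsfun.
by apply: cvgeZl.
Qed.

End IntegralFactor.

Section Independence.
Context d d' (T : measurableType d) (T' : measurableType d') (R : realType).
Variables (P : probability T R) (I : finType) (X : I -> T -> T').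
Hypotheses (mX : forall i, measurable_fun setT (X i)) (indX : mutually_independent P X).

Let mX_pre i A : measurable A -> measurable (X i @^-1` A).
Proof. by move=> mA; rewrite -[X in measurable X]setTI; exact: mX. Qed.

Lemma prod_indic_preimage (l : seq I) (A : I -> set T') w :
  \prod_(i <- l) \1_(A i) (X i w) =
  \1_(\bigcap_(i in [set` [set i in l]%SET]) X i @^-1` A i) w :> R.
Proof.
have [H|H] := pselect (forall i, i \in l -> A i (X i w)).
  rewrite [RHS]indicE mem_set; last by move=> i /=; rewrite inE => /H.
  by rewrite big_seq big1// => i /H Ai; rewrite indicE mem_set.
rewrite [RHS]indicE memNset => [|Hw]; last first.
  by apply: H => i il; apply: (Hw i); rewrite /= inE.
have [i [il nA]] : exists i, i \in l /\ ~ A i (X i w).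
  by apply: contra_notP H => H i il; apply: contra_notP H => nA; exists i.
by rewrite (big_rem i)//= indicE memNset// mul0r.
Qed.

Variables (f : T' -> R) (c : R).
Hypotheses (mf : measurable_fun setT f) (f0 : forall y, 0 <= f y).
Hypothesis Ef : forall i, (\int[P]_w (f (X i w))%:E = c%:E)%E.

(** Indicators become values of [f] one index at a time: the induction hypothesis with one more
    indicator, that of [e], is the premise of [integral_factor] for [f (X e w)]. The base case is
    independence itself. *)
Lemma integral_prod_indic (l l2 : seq I) (A : I -> set T') :
  uniq (l ++ l2) -> (forall i, measurable (A i)) ->
  (\int[P]_w (\prod_(i <- l) f (X i w) * \prod_(i <- l2) \1_(A i) (X i w))%:E =
   (c ^+ size l * \prod_(i <- l2) fine (P (X i @^-1` A i)))%:E)%E.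
Proof.
elim: l l2 A => [|e l IH] l2 A.
  move=> ul2 mA; under eq_integral do rewrite big_nil mul1r prod_indic_preimage.
  rewrite integral_indic//; last first.
    by apply: fin_bigcap_measurable => // i _; exact: mX_pre.
  rewrite setIT; apply: (etrans (indX [set i in l2]%SET mA)).
  rewrite mul1r -prodEFin.
  rewrite (eq_bigl (mem l2)) => [|i]; last by rewrite inE.
  rewrite -big_uniq//=; apply: eq_bigr => i _.
  by rewrite fineK// fin_num_measure//; exact: mX_pre.
rewrite cat_cons cons_uniq => /andP[el ul] mA.
pose h w := \prod_(i <- l) f (X i w) * \prod_(i <- l2) \1_(A i) (X i w).
pose C := c ^+ size l * \prod_(i <- l2) fine (P (X i @^-1` A i)).
have mind i B : measurable B -> measurable_fun setT (fun w => \1_B (X i w) : R).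
  by move=> mB; apply: (measurableT_comp (measurable_indic _) (mX i)).
have c0 : 0 <= c.
  by rewrite -lee_fin -(Ef e); apply: integral_ge0 => w _; rewrite lee_fin.
transitivity (\int[P]_w (h w * f (X e w))%:E)%E.
  by apply: eq_integral => w _; rewrite big_cons /h mulrC mulrA mulrC; congr (_%:E); ring.
rewrite (@integral_factor _ _ _ _ _ P h (X e) C)//.
- by rewrite Ef -EFinM /C exprS; congr (_%:E); ring.
- apply: measurable_funM; apply: measurable_prod => i _; last exact: mind.
  exact: measurableT_comp (mX i).
- by move=> w; apply: mulr_ge0; apply: prodr_ge0 => i _ //; rewrite indicE.
move=> B mB; pose A' i := if i == e then B else A i.
have mA' i : measurable (A' i) by rewrite /A'; case: ifP.
have A'E i : i \in l2 -> A' i = A i.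
  move=> il2; rewrite /A'; case: eqP => // ie; move: el.
  by rewrite -ie mem_cat il2 orbT.
have ul' : uniq (l ++ e :: l2).
  move: el ul; rewrite mem_cat negb_or !cat_uniq /= => /andP[el el2].
  by case/and3P => -> /negbTE -> ->; rewrite (negbTE el) el2.
have := IH (e :: l2) A' ul' mA'.
have -> : \prod_(i <- e :: l2) fine (P (X i @^-1` A' i)) =
    fine (P (X e @^-1` B)) * \prod_(i <- l2) fine (P (X i @^-1` A i)).
  rewrite big_cons /A' eqxx; congr (_ * _); apply: eq_big_seq => i il2.
  by rewrite -/(A' i) A'E.
rewrite mulrCA mulrC EFinM fineK; last by apply: fin_num_measure; exact: mX_pre.
rewrite -/C muleC => <-; apply: eq_integral => w _; congr (_%:E).
rewrite /h -mulrA; congr (_ * _); rewrite big_cons /A' eqxx mulrC; congr (_ * _).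
by apply: eq_big_seq => i il2; rewrite -/(A' i) A'E.
Qed.

Lemma integral_prod_independent (l : seq I) : uniq l ->
  (\int[P]_w (\prod_(i <- l) f (X i w))%:E = (c ^+ size l)%:E)%E.
Proof.
move=> ul; have := @integral_prod_indic l [::] (fun=> setT).
rewrite cats0 big_nil mulr1 => /(_ ul (fun=> measurableT)) <-.
by apply: eq_integral => w _; rewrite big_nil mulr1.
Qed.

End Independence.

(** * Joint laws of finite families *)

Section CoordinateSigmaAlgebra.
Context d' (T' : measurableType d') (I : finType).

(** The pi-system that generates the product sigma-algebra on [I -> T']. *)
Definition boxes : set (set (I -> T')) :=
  [set S | exists2 A : I -> set T', (forall i, measurable (A i)) &
     S = [set a | forall i, A i (a i)]].

Lemma boxes_setI : setI_closed boxes.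
Proof.
move=> _ _ [A mA ->] [B mB ->]; exists (fun i => A i `&` B i).
  by move=> i; exact: measurableI.
by apply/seteqP; split => a /= => [[Aa Ba] i|ABa]; [|split => i; have [] := ABa i].
Qed.

Lemma measurable_eval (i : I) :
  measurable_fun [set: g_sigma_algebraType boxes] (fun a : I -> T' => a i).
Proof.
move=> _ B mB; rewrite setTI; apply: sub_sigma_algebra.
exists (fun j => if j == i then B else setT); first by move=> j; case: ifP.
apply/seteqP; split => a /= => [Ba j|/(_ i)]; last by rewrite eqxx.
by case: eqP => // ->.
Qed.

Context d (T : measurableType d) (R : realType) (P : probability T R).

Lemma box_preimage (X : I -> T -> T') (A : I -> set T') :
  (fun w i => X i w) @^-1` [set a | forall i, A i (a i)] =
  \bigcap_(i in [set` [set: I]%SET]) X i @^-1` A i.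
Proof. by apply/seteqP; split => w /= H i => [_|]; apply: H => //=; rewrite inE. Qed.

Lemma measurable_joint (X : I -> T -> T') : (forall i, measurable_fun setT (X i)) ->
  measurable_fun setT ((fun w i => X i w) : T -> g_sigma_algebraType boxes).
Proof.
move=> mX; apply: (@measurability _ _ T (g_sigma_algebraType boxes) setT (fun w i => X i w) boxes) => // _ [_ [A mA ->] <-].
rewrite setTI box_preimage; apply: fin_bigcap_measurable => // i _.
by rewrite -[X in measurable X]setTI; exact: mX.
Qed.

(** Finite measures that agree on the pi-system of boxes are equal, and on boxes independence
    reduces the comparison to the marginals. *)
Lemma independent_joint_law (X Y : I -> T -> T') :
  (forall i, measurable_fun setT (X i)) -> (forall i, measurable_fun setT (Y i)) ->
  mutually_independent P X -> mutually_independent P Y ->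
  (forall i (A : set T'), measurable A -> P (X i @^-1` A) = P (Y i @^-1` A)) ->
  forall S : set (g_sigma_algebraType boxes), measurable S ->
    P ((fun w i => X i w) @^-1` S) = P ((fun w i => Y i w) @^-1` S).
Proof.
move=> mX mY indX indY XY S mS.
pose jX : T -> g_sigma_algebraType boxes := fun w i => X i w.
pose jY : T -> g_sigma_algebraType boxes := fun w i => Y i w.
pose mjX := isMeasurableFun.Build _ _ _ _ jX (measurable_joint mX).
pose mjY := isMeasurableFun.Build _ _ _ _ jY (measurable_joint mY).
pose X' : {mfun T >-> g_sigma_algebraType boxes} := HB.pack jX mjX.
pose Y' : {mfun T >-> g_sigma_algebraType boxes} := HB.pack jY mjY.
apply: (@measure_unique _ R (g_sigma_algebraType boxes) boxes (fun=> setT) _ _ _ _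
  (distribution P X') (distribution P Y')) => //.
- exact: boxes_setI.
- by move=> _; exists (fun=> setT) => //; apply/seteqP.
- by apply/seteqP; split => // a _; exists 0%N.
- move=> _ [A mA ->].
  transitivity (\prod_(i in [set: I]%SET) P (X i @^-1` A i))%E.
    by rewrite -indX// -box_preimage.
  transitivity (\prod_(i in [set: I]%SET) P (Y i @^-1` A i))%E; last first.
    by rewrite -indY// -box_preimage.
  by apply: eq_bigr => i _; exact: XY.
- move=> k; apply: le_lt_trans (ltry 1).
  exact: (@probability_le1 _ _ _ (distribution P X') setT).
Qed.

End CoordinateSigmaAlgebra.

(** * Tail bound *)

Section ExpectationBound.
Context d (T : measurableType d) (R : realType) (P : {measure set T -> \bar R}).
Implicit Types (F G : T -> R).

(** Bundled so that bounds on means pass through nested finite sums without separate measurability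
    proofs. *)
Definition mean_le F v :=
  [/\ measurable_fun setT F, forall w, 0 <= F w & (\int[P]_w (F w)%:E <= v%:E)%E].

Lemma mean_le0 : mean_le (fun=> 0) 0.
Proof. by split => //; rewrite integral0. Qed.

Lemma mean_leD F G v v' : mean_le F v -> mean_le G v' ->
  mean_le (fun w => F w + G w) (v + v').
Proof.
move=> [mF F0 Fv] [mG G0 Gv]; split; first exact: measurable_funD.
  by move=> w; rewrite addr_ge0.
under eq_integral do rewrite EFinD.
rewrite ge0_integralD//=; first by rewrite EFinD leeD.
- by move=> w _; rewrite lee_fin.
- exact/measurable_EFinP.
- by move=> w _; rewrite lee_fin.
- exact/measurable_EFinP.
Qed.

Lemma mean_leZ k F v : 0 <= k -> mean_le F v -> mean_le (fun w => k * F w) (k * v).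
Proof.
move=> k0 [mF F0 Fv]; split; first by apply: measurable_funM => //; exact: measurable_cst.
  by move=> w; rewrite mulr_ge0.
under eq_integral do rewrite EFinM.
rewrite ge0_integralZl//=; first by rewrite EFinM lee_pmul ?lee_fin// integral_ge0// => w _; rewrite lee_fin.
- exact/measurable_EFinP.
- by move=> w _; rewrite lee_fin.
Qed.

Lemma mean_le_sum (I : Type) (r : seq I) (Q : pred I) (F : I -> T -> R) (v : I -> R) :
  (forall i, Q i -> mean_le (F i) (v i)) ->
  mean_le (fun w => \sum_(i <- r | Q i) F i w) (\sum_(i <- r | Q i) v i).
Proof.
move=> Fv; elim: r => [|i r IH].
  by rewrite big_nil; under eq_fun do rewrite big_nil; exact: mean_le0.
under eq_fun do rewrite big_cons; rewrite big_cons.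
by case: ifPn => // Qi; exact: mean_leD (Fv i Qi) IH.
Qed.

End ExpectationBound.

Section RandomMatrix.
Context d d0 (T : measurableType d) (T0 : measurableType d0) (R : realType).
Variables (P : probability T R) (P0 : probability T0 R) (N : nat).
Local Notation V := 'I_N.
Variables (X : V * V -> T -> R[i]) (x : T0 -> R[i]).
Hypotheses (mX : forall e, measurable_fun setT (X e)) (mx : measurable_fun setT x).
Hypothesis indX : mutually_independent P X.
Hypothesis lawX : forall e, same_law P P0 (X e) x.
Hypothesis symx : symmetric_law P0 x.

Lemma measurable_complexN : measurable_fun [set: R[i]] (fun z => - z).
Proof.
under eq_fun do rewrite -mulN1r.
by apply: measurable_complexM; [exact: measurable_cst|exact: measurable_id].
Qed.

Definition flipX (sg : {ffun V * V -> bool}) e w := (-1) ^+ sg e * X e w.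

Lemma flipX_law sg e (A : set R[i]) : measurable A ->
  P (X e @^-1` A) = P (flipX sg e @^-1` A).
Proof.
move=> mA; rewrite /flipX; case: (sg e).
  have mNA : measurable ((fun z : R[i] => - z) @^-1` A).
    by rewrite -[X in measurable X]setTI; exact: measurable_complexN.
  have -> : (fun w => (-1) ^+ true * X e w) @^-1` A = X e @^-1` ((fun z => - z) @^-1` A).
    by apply/seteqP; split => w /=; rewrite expr1 mulN1r.
  exact: etrans (lawX e mA) (etrans (symx mA) (esym (lawX e mNA))).
rewrite expr0 (_ : (fun w => 1 * X e w) = X e)//.
by apply/funext => w; rewrite mul1r.
Qed.

Lemma measurable_flipX sg e : measurable_fun setT (flipX sg e).
Proof. by apply: measurable_complexM => //; exact: measurable_cst. Qed.

Lemma flipX_independent sg : mutually_independent P (flipX sg).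
Proof.
move=> J A mA; pose A' e := (fun z : R[i] => (-1) ^+ sg e * z) @^-1` A e.
have mA' e : measurable (A' e).
  have mf : measurable_fun [set: R[i]] (fun z => (-1) ^+ sg e * z).
    by apply: measurable_complexM; [exact: measurable_cst|exact: measurable_id].
  by rewrite -[X in measurable X]setTI; exact: mf.
exact: (indX J mA').
Qed.

(** By symmetry of [x], flipped entries keep independence and marginals, hence the joint law. *)
Lemma large_power_flipX t m sg :
  P [set w | large_power t m (X^~ w)] = P [set w | large_power t m (flip sg (X^~ w))].
Proof.
have mS : measurable ([set a | large_power t m a] : set (g_sigma_algebraType (@boxes _ R[i] (V * V)%type))).
  apply: (@measurable_ge_cst _ (g_sigma_algebraType _) R).
  apply: measurable_sum_normc_sqr => i j.
  have := @measurable_eval _ R[i] (V * V)%type (i, j).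
  by congr measurable_fun; apply/funext => a; rewrite mxE.
exact: (independent_joint_law mX (measurable_flipX sg) indX (flipX_independent sg)
   (@flipX_law sg) mS).
Qed.

Lemma integral_same_law (f : R[i] -> R) e :
  measurable_fun setT f -> (forall z, 0 <= f z) ->
  (\int[P]_w (f (X e w))%:E = \int[P0]_w (f (x w))%:E)%E.
Proof.
move=> mf f0.
pose mXe := isMeasurableFun.Build _ _ _ _ (X e) (mX e).
pose mx' := isMeasurableFun.Build _ _ _ _ x mx.
pose X' : {mfun T >-> R[i]} := HB.pack (X e) mXe.
pose x' : {mfun T0 >-> R[i]} := HB.pack x mx'.
have mEf : measurable_fun setT (EFin \o f) by exact/measurable_EFinP.
have Ef0 z : (0 <= (EFin \o f) z)%E by rewrite lee_fin.
have := @ge0_integral_distribution _ _ _ _ _ P X' _ mEf Ef0.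
have := @ge0_integral_distribution _ _ _ _ _ P0 x' _ mEf Ef0.
rewrite /comp /= => <- <-; apply: eq_measure_integral => A mA _.
exact: lawX.
Qed.

Lemma mean_le_prod (f : R[i] -> R) c v (l : seq (V * V)) :
  measurable_fun setT f -> (forall z, 0 <= f z) ->
  (\int[P0]_w (f (x w))%:E = c%:E)%E -> c <= v -> uniq l ->
  mean_le P (fun w => \prod_(e <- l) f (X e w)) (v ^+ size l).
Proof.
move=> mf f0 fc cv ul; split.
- by apply: measurable_prod => e _; exact: measurableT_comp (mX e).
- by move=> w; apply: prodr_ge0.
have c0 : 0 <= c.
  by rewrite -lee_fin -fc; apply: integral_ge0 => w _; rewrite lee_fin.
rewrite (integral_prod_independent mX indX mf f0 (c := c))//.
  by rewrite lee_fin lerXn2r// nnegrE (le_trans c0).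
by move=> e; rewrite integral_same_law.
Qed.

(** All events [S sg] have the same probability, which is therefore the mean of their averaged
    indicators; [sum_large_power_le] bounds this average pointwise. *)
Lemma large_power_tail p t L m hb lb : 0 < p -> 0 < t -> 1 <= L ->
  mean_le P (fun w => heavy_paths p L (X^~ w)) hb ->
  mean_le P (fun w => light_walks t L m (X^~ w)) lb ->
  (P [set w | large_power t m (X^~ w)] <= (hb + lb)%:E)%E.
Proof.
move=> p0 t0 L1 hbP lbP.
pose K : R := #|{ffun V * V -> bool}|%:R.
have K0 : 0 < K by rewrite ltr0n; apply/card_gt0P; exists [ffun=> false].
pose S sg := [set w | large_power t m (flip sg (X^~ w))].
have mS sg : measurable (S sg).
  apply: measurable_ge_cst; apply: measurable_sum_normc_sqr => i j.
  by under eq_fun do rewrite mxE; exact: measurable_flipX.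
rewrite -(@lee_pmul2l _ K%:E) ?lte_fin//.
have -> : (K%:E * P [set w | large_power t m (X^~ w)] = \sum_sg P (S sg))%E.
  have mlp : measurable [set w | large_power t m (X^~ w)].
    apply: measurable_ge_cst; apply: measurable_sum_normc_sqr => i j.
    by under eq_fun do rewrite mxE; exact: mX.
  have SE sg : P (S sg) = P [set w | large_power t m (X^~ w)].
    exact: esym (large_power_flipX t m sg).
  under eq_bigr do rewrite SE.
  have -> : P [set w | large_power t m (X^~ w)] =
      (fine (P [set w | large_power t m (X^~ w)]))%:E.
    by apply/esym/fineK; apply: fin_num_measure; exact: mlp.
  by rewrite sumEFin sumr_const -EFinM mulr_natl.
have [mHL HL0 HLv] := mean_leZ (ltW K0) (mean_leD hbP lbP).
rewrite -EFinM; apply: le_trans HLv.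
under eq_bigr do rewrite -[X in P X]setIT -integral_indic//.
rewrite -ge0_integral_sum//; last first.
  by move=> sg; apply/measurable_EFinP; exact: measurable_indic.
apply: ge0_le_integral => //.
- by move=> w _; apply: sume_ge0 => sg _; rewrite lee_fin.
- by apply: emeasurable_sum => sg; apply/measurable_EFinP; exact: measurable_indic.
- exact/measurable_EFinP.
move=> w _; rewrite sumEFin lee_fin.
apply: le_trans (sum_large_power_le m p0 t0 L1 _).
apply: ler_sum => sg _; rewrite indicE.
have [H|/negP H] := boolP (large_power t m (flip sg (X^~ w))).
  by rewrite mem_set.
by rewrite memNset.
Qed.

Lemma mean_le_trans (F : T -> R) v v' : mean_le P F v -> v <= v' -> mean_le P F v'.
Proof. by move=> [mF F0 Fv] vv'; split=> //; rewrite (le_trans Fv)// lee_fin. Qed.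

(** The steps of a simple cycle have distinct origins, so the entries along it are independent. *)
Lemma uniq_closed_edges (y : V) s : uniq (y :: s) -> uniq (closed_edges y s).
Proof.
move=> us; apply: (@map_uniq _ _ fst).
have -> : [seq e.1 | e <- closed_edges y s] = last y s :: belast y s.
  rewrite /closed_edges /=; congr cons.
  by elim: s y {us} => //= z s IH y; rewrite IH.
by move: us; rewrite lastI rcons_uniq.
Qed.

(** The additional term on the left carries the induction. *)
Lemma geometric_sum_le (r : R) n : 0 <= r -> r <= 2^-1 ->
  \sum_(k < n) r ^+ k.+1 + 2 * r ^+ n.+1 <= 2 * r.
Proof.
move=> r0 r2; elim: n => [|n IH]; first by rewrite big_ord0 add0r expr1.
rewrite big_ord_recr /= -addrA (le_trans _ IH)// lerD2l.
rewrite [r ^+ n.+2]exprS; have : 0 <= r ^+ n.+1 by rewrite exprn_ge0.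
move: (r ^+ n.+1) => z z0; have : 0 <= z * (2^-1 - r) by rewrite mulr_ge0// subr_ge0.
by move=> H; lra.
Qed.

Lemma sum_words1 n : \sum_(s <- words V n) 1 = N%:R ^+ n :> R.
Proof.
elim: n => [|n IH]; first by rewrite big_words0 expr0.
by rewrite big_wordsS; under eq_bigr do rewrite IH; rewrite sumr_const card_ord exprS mulr_natl.
Qed.

(** At most [N ^ (k + 1)] simple paths have [k] steps; by independence the product along each, or
    along the cycle closing it, has mean at most [B ^ (k + 1)]. In the factor [4], one [2] is for
    paths and cycles, the other for the geometric series. *)
Lemma mean_le_heavy_paths p L B c : 0 < L `^ p -> 1 <= B -> c <= B ->
  (\int[P0]_w ((normc (x w) ^+ 2) `^ p)%:E = c%:E)%E ->
  N%:R * B / L `^ p <= 2^-1 ->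
  mean_le P (fun w => heavy_paths p L (X^~ w)) (4 * (N%:R * B / L `^ p)).
Proof.
rewrite /heavy_paths; move: (L `^ p) => D D0 B1 cB fc; set r := (_ * _ / _) => r2.
pose f (z : R[i]) := (normc z ^+ 2) `^ p.
have mf : measurable_fun setT f.
  apply: (measurableT_comp (measurable_powR p)); apply: measurable_funX.
  exact: measurable_normc.
have f0 z : 0 <= f z by rewrite powR_ge0.
have B0 : 0 <= B by rewrite (le_trans ler01).
have r0 : 0 <= r by rewrite divr_ge0 ?mulr_ge0// ltW.
pose v := \sum_(k < N) \sum_(y : V) \sum_(s <- words V k | uniq (y :: s))
  (D ^+ k.+1)^-1 * (B ^+ size (edges y s) + B ^+ size (closed_edges y s)).
apply: (@mean_le_trans _ v).
  apply: mean_le_sum => k _; apply: mean_le_sum => y _; apply: mean_le_sum => s us.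
  under eq_fun do rewrite mulrC.
  apply: mean_leZ; first by rewrite invr_ge0 exprn_ge0// ltW.
  have uc := uniq_closed_edges us.
  have ue : uniq (edges y s) by move: uc; rewrite /= => /andP[].
  by apply: mean_leD; apply: (mean_le_prod mf f0 fc).
apply: (@le_trans _ _ (\sum_(k < N) 2 * r ^+ k.+1)); last first.
  have := geometric_sum_le N r0 r2; have : 0 <= r ^+ N.+1 by rewrite exprn_ge0.
  by rewrite -mulr_sumr; lra.
apply: ler_sum => k _; rewrite /r expr_div_n exprMn.
have Dk : 0 <= (D ^+ k.+1)^-1 by rewrite invr_ge0 exprn_ge0// ltW.
apply: (@le_trans _ _ (\sum_(y : V) \sum_(s <- words V k) (D ^+ k.+1)^-1 * (2 * B ^+ k.+1))).
  apply: ler_sum => y _; rewrite [leLHS]big_seq_cond [leLHS]big_mkcondr /= [leRHS]big_seq.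
  apply: ler_sum => s; rewrite mem_words => /eqP sk.
  case: ifP => _; last by rewrite !mulr_ge0 ?exprn_ge0.
  rewrite ler_wpM2l// size_edges sk.
  have : B ^+ k <= B ^+ k.+1 by rewrite exprS ler_peMl// exprn_ge0.
  by lra.
under eq_bigr do rewrite -[X in \sum_(_ <- _) X]mulr1 -mulr_sumr sum_words1.
rewrite sumr_const card_ord -mulr_natl exprS [N%:R ^+ k.+1]exprS.
by rewrite le_eqVlt; apply/orP; left; apply/eqP; ring.
Qed.

(** Products over distinct entries have mean at most [1], so only the count [even_pair_sum]
    remains. *)
Lemma mean_le_light_walks t L m c : 0 < t -> 0 <= L -> c <= 1 ->
  (\int[P0]_w (normc (x w) ^+ 2)%:E = c%:E)%E ->
  (0 < N)%N -> L * (2 * m.+1)%:R ^+ 8 <= N%:R ->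
  mean_le P (fun w => light_walks t L m (X^~ w))
    (N%:R ^+ 2 / t ^+ (2 * m) * (expR 1 * (2 * m.+1)%:R ^+ 2 * N%:R ^+ m.+1)).
Proof.
move=> t0 L0 c1 fc N0 LN.
pose f (z : R[i]) := normc z ^+ 2.
have mf : measurable_fun setT f by apply: measurable_funX; exact: measurable_normc.
have f0 z : 0 <= f z by rewrite exprn_ge0// normc_ge0.
apply: mean_leZ; first by rewrite divr_ge0 ?exprn_ge0// ltW.
have := @even_pair_sum V R m L; rewrite card_ord => /(_ N0 L0 LN).
apply: mean_le_trans.
apply: mean_le_sum => y _; apply: mean_le_sum => s _; apply: mean_le_sum => s' _.
rewrite -[X in mean_le _ _ X]mulr1; apply: mean_leZ; first by rewrite mulr_ge0 ?exprn_ge0.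
rewrite -[X in mean_le _ _ X](expr1n _ (size (undup (edges y s ++ edges y s')))).
by apply: (mean_le_prod mf f0 fc) => //; exact: undup_uniq.
Qed.

Lemma spectral_radius_tail (p t L B c1 c2 : R) (m : nat) : 0 < p -> 0 < t -> 1 <= L ->
  (\int[P0]_w (normc (x w) ^+ 2)%:E = c1%:E)%E -> c1 <= 1 ->
  (\int[P0]_w ((normc (x w) ^+ 2) `^ p)%:E = c2%:E)%E -> c2 <= B -> 1 <= B ->
  (0 < N)%N -> N%:R * B / L `^ p <= 2^-1 -> L * (2 * m.+1)%:R ^+ 8 <= N%:R ->
  (P [set w | (t <= spectral_radius (\matrix_(i, j) X (i, j) w))%R] <=
   (4 * (N%:R * B / L `^ p) +
    N%:R ^+ 2 / t ^+ (2 * m) * (expR 1 * (2 * m.+1)%:R ^+ 2 * N%:R ^+ m.+1))%:E)%E.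
Proof.
move=> p0 t0 L1 E1 c1le E2 c2B B1 N0 r2 LN.
have L0 : 0 < L by apply: lt_le_trans L1.
have heavy := mean_le_heavy_paths (powR_gt0 p L0) B1 c2B E2 r2.
have light := mean_le_light_walks t0 (ltW L0) c1le E1 N0 LN.
apply: (le_trans _ (large_power_tail p0 t0 L1 heavy light)).
apply: le_measure; rewrite ?inE.
- apply: measurable_spectral_radius_ge => // i j.
  by under eq_fun do rewrite mxE; exact: mX.
- apply: measurable_ge_cst; apply: measurable_sum_normc_sqr => i j.
  by under eq_fun do rewrite mxE; exact: mX.
move=> w /= tr; apply: spectral_radius_sqr_le => //; exact: ltW.
Qed.

End RandomMatrix.

(** * Choice of the parameters *)

Section Numerics.
Variable R : realType.
Implicit Types (a b u v : R) (N : nat).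

(** The [k]-th power of [y <= expR y] at [y = a / k * ln N]. *)
Lemma expr_ln_le_powR N (k : nat) a : (2 <= N)%N -> 0 < a -> (0 < k)%N ->
  (a / k%:R * ln N%:R) ^+ k <= N%:R `^ a.
Proof.
move=> N2 a0 k0; have N0 : 0 < N%:R :> R by rewrite ltr0n (leq_trans _ N2).
have lnN : 0 <= ln N%:R :> R by rewrite ln_ge0// ler1n (leq_trans _ N2).
have k0R : 0 < k%:R :> R by rewrite ltr0n.
rewrite /powR gt_eqF//.
have -> : a * ln N%:R = k%:R * (a / k%:R * ln N%:R) by field; rewrite gt_eqF.
rewrite expRM_natl lerXn2r ?nnegrE ?expR_ge0 ?mulr_ge0 ?divr_ge0 ?(ltW a0)//.
by apply: le_trans (expR_ge1Dx _); rewrite lerDr.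
Qed.

Lemma window_le (k l : nat) : (0 < l)%N ->
  (2 * (k * l.+1).+1 <= 2 * (2 * k + 1) * l)%N.
Proof.
move=> l0; have := leq_pmulr k l0.
have -> : (2 * (2 * k + 1) * l = 4 * (k * l) + 2 * l)%N by ring.
by rewrite (mulnS k); move: (k * l)%N => z; lia.
Qed.

Lemma tail_parameters eps delta b : 0 < eps -> 0 < delta -> 1 <= b ->
  exists2 C : R, 0 < C & forall N, (2 <= N)%N -> C / ln N%:R ^+ 2 < 1 ->
    exists L m, [/\ 1 <= L, N%:R * b / L `^ (1 + eps / 2) <= 2^-1,
      L * (2 * m.+1)%:R ^+ 8 <= N%:R &
      4 * (N%:R * b / L `^ (1 + eps / 2)) +
      N%:R ^+ 2 / ((1 + delta) * Num.sqrt N%:R) ^+ (2 * m) *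
        (expR 1 * (2 * m.+1)%:R ^+ 2 * N%:R ^+ m.+1) <= C / ln N%:R ^+ 2].
Proof.
move=> eps0 delta0 b1; have b0 : 0 < b by apply: lt_le_trans b1.
(* These satisfy [(1 - eta) * (1 + eps / 2) = 1 + th], so [L = N ^ (1 - eta)] makes the ratio of the
   heavy series [b / N ^ th]. *)
pose eta : R := eps / (2 * (2 + eps)); pose th : R := eps / 4.
have e2 : 0 < 2 * (2 + eps) by rewrite mulr_gt0// addr_gt0.
have eta0 : 0 < eta by rewrite divr_gt0.
have eta1 : eta < 1 by rewrite ltr_pdivrMr// mul1r; lra.
have th0 : 0 < th by rewrite divr_gt0.
pose q := (1 + delta) ^+ 2.
have q1 : 1 < q by rewrite /q expr2; nra.
(* As [32 = 2 ^ 5], taking [m = k0 * (l + 1)] with [N < 2 ^ (l + 1)] gives [q ^+ m >= N ^ 5]. *)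
have [k0 k00 k0P] := exists_expr_ge 32 q1.
pose K := (2 * (2 * k0 + 1))%N.
(* Once [lam >= D], the spare ninth factor [lam] absorbs the constants in [(K * lam / ln 2) ^ 8 <=
   (eta / 9 * lam) ^ 9], whence [n ^ 8 <= N ^ eta]. *)
pose D : R := K%:R ^+ 8 * (ln 2) ^- 8 * (eta / 9) ^- 9.
have ln2 : 0 < ln 2 :> R by rewrite ln_gt0// ltr1n.
(* The first two terms bound the heavy and the light part. When [C < lam ^+ 2], the first also keeps
   the heavy ratio below [1 / 2], and the third gives [D <= lam]. *)
pose C := 16 * b / th ^+ 2 + 4 * expR 1 + D ^+ 2.
have bt0 : 0 < 16 * b / th ^+ 2 by rewrite divr_gt0 ?exprn_gt0// mulr_gt0.
have D20 : 0 <= D ^+ 2 by rewrite sqr_ge0.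
have e10 : 0 < expR 1 :> R by rewrite expR_gt0.
exists C; first by rewrite /C; lra.
move=> N N2; set lam := ln N%:R.
have N0 : 0 < N%:R :> R by rewrite ltr0n (leq_trans _ N2).
have N1 : 1 <= N%:R :> R by rewrite ler1n (leq_trans _ N2).
have lam0 : 0 < lam by rewrite ln_gt0// ltr1n.
rewrite ltr_pdivrMr ?exprn_gt0// mul1r => Clam.
have [l [l1 lN Nl]] : exists l, [/\ (0 < l)%N, (2 ^ l <= N)%N & (N < 2 ^ l.+1)%N].
  exists (trunc_log 2 N); split; first by rewrite trunc_log_gt0.
    by rewrite trunc_logP// (leq_trans _ N2).
  by rewrite trunc_log_ltn.
pose m := (k0 * l.+1)%N; pose n := (2 * m.+1)%N.
have nK : (n <= K * l)%N by exact: window_le.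
have nKl : n%:R <= K%:R * l%:R :> R by rewrite -natrM ler_nat.
have l_lam : l%:R <= lam / ln 2.
  rewrite ler_pdivlMr// mulr_natl -lnXn// ler_ln ?posrE ?exprn_gt0//.
  by rewrite -natrX ler_nat.
pose a := 1 - eta.
exists (N%:R `^ a), m.
have ap : N%:R `^ a `^ (1 + eps / 2) = N%:R * N%:R `^ th.
  have -> : N%:R * N%:R `^ th = N%:R `^ (1 + th).
    rewrite powRD; last by rewrite (gt_eqF N0) implybT.
    by rewrite powRr1 ?(ltW N0).
  rewrite -powRrM; congr (_ `^ _); rewrite /a /eta /th.
  by field; rewrite gt_eqF// addr_gt0.
have rE : N%:R * b / N%:R `^ a `^ (1 + eps / 2) = b / N%:R `^ th.
  by rewrite ap; field; rewrite !gt_eqF// powR_gt0.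
have th_lam : (th / 2 * lam) ^+ 2 <= N%:R `^ th by exact: expr_ln_le_powR.
have th0' : 0 < th / 2 * lam by rewrite mulr_gt0// divr_gt0.
have Nth0 : 0 < N%:R `^ th by rewrite powR_gt0.
have bth : 4 * b <= (th / 2 * lam) ^+ 2.
  have : 16 * b / th ^+ 2 <= lam ^+ 2 by apply: le_trans (ltW Clam); rewrite /C; lra.
  rewrite ler_pdivrMr ?exprn_gt0// => H.
  have -> : (th / 2 * lam) ^+ 2 = lam ^+ 2 * th ^+ 2 / 4 by field.
  by lra.
have Na1 : 1 <= N%:R `^ a.
  have a0 : 0 <= a by rewrite subr_ge0 ltW.
  by have := ler_powR N1 a0; rewrite powRr0.
have n8 : n%:R ^+ 8 <= N%:R `^ eta.
  have Dlam : D <= lam.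
    have D0 : 0 <= D by rewrite !mulr_ge0 ?invr_ge0 ?exprn_ge0// ltW// divr_gt0.
    rewrite -(@ler_pXn2r _ 2)// ?nnegrE ?(ltW lam0)//.
    by apply: le_trans (ltW Clam); rewrite /C; lra.
  have eta9 : 0 < eta / 9 by rewrite divr_gt0.
  apply: le_trans (@expr_ln_le_powR N 9 eta N2 eta0 isT); rewrite -/lam.
  apply: (@le_trans _ _ ((K%:R * (lam / ln 2)) ^+ 8)).
    have KL0 : 0 <= K%:R * (lam / ln 2) by rewrite mulr_ge0// divr_ge0// ltW.
    rewrite lerXn2r ?nnegrE//.
    by rewrite (le_trans nKl)// ler_wpM2l.
  have -> : (K%:R * (lam / ln 2)) ^+ 8 = K%:R ^+ 8 * (ln 2) ^- 8 * lam ^+ 8.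
    by rewrite !exprMn exprVn; ring.
  have -> : (eta / 9 * lam) ^+ 9 = lam * (eta / 9) ^+ 9 * lam ^+ 8 by ring.
  rewrite ler_pM2r ?exprn_gt0//.
  by move: Dlam; rewrite /D ler_pdivrMr ?exprn_gt0.
have NaN : N%:R `^ a * N%:R `^ eta = N%:R.
  rewrite -powRD; last by rewrite (gt_eqF N0) implybT.
  by rewrite /a subrK powRr1// ltW.
have n8N : N%:R `^ a * n%:R ^+ 8 <= N%:R.
  by rewrite -[leRHS]NaN ler_wpM2l ?powR_ge0.
split=> //; rewrite rE.
  by rewrite ler_pdivrMr//; lra.
have n2N : n%:R ^+ 2 <= N%:R :> R.
  apply: le_trans n8N; rewrite -[leLHS]mul1r ler_pM ?exprn_ge0//.
  by rewrite ler_weXn2l// ler1n.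
have qm : N%:R ^+ 5 <= q ^+ m.
  rewrite /m exprM; apply: (@le_trans _ _ (32 ^+ l.+1)); last by rewrite lerXn2r ?nnegrE// exprn_ge0// (le_trans ler01)// ltW.
  have -> : (32 : R) = (2 ^ 5)%:R by [].
  by rewrite -!natrX ler_nat -expnM mulnC expnM leq_exp2r// ltnW.
have tm : ((1 + delta) * Num.sqrt N%:R) ^+ (2 * m) = q ^+ m * N%:R ^+ m.
  have sq : ((1 + delta) * Num.sqrt N%:R) ^+ 2 = q * N%:R.
    by rewrite exprMn sqr_sqrtr// ltW.
  by rewrite exprM sq exprMn.
have lamN : (1 / 2 * lam) ^+ 2 <= N%:R.
  by rewrite -[leRHS]powRr1 ?(ltW N0)//; exact: expr_ln_le_powR.
have qm0 : 0 < q ^+ m by rewrite exprn_gt0// (lt_trans ltr01).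
(* The powers [N ^ m] cancel. What remains is at most [e * N ^ 4 / N ^ 5], and
   [lam ^ 2 <= 4 * N]. *)
have light : N%:R ^+ 2 / ((1 + delta) * Num.sqrt N%:R) ^+ (2 * m) *
    (expR 1 * n%:R ^+ 2 * N%:R ^+ m.+1) <= 4 * expR 1 / lam ^+ 2.
  rewrite tm [N%:R ^+ m.+1]exprS [leLHS](_ : _ = expR 1 * (n%:R ^+ 2 * N%:R ^+ 3 / q ^+ m)); last first.
    have fE (w y z E : R) : y != 0 -> w != 0 ->
        N%:R ^+ 2 / (y * w) * (E * z ^+ 2 * (N%:R * w)) = E * (z ^+ 2 * N%:R ^+ 3 / y).
      by move=> y0 w0; field; rewrite y0.
    by rewrite fE// gt_eqF// exprn_gt0.
  rewrite [leRHS](_ : _ = expR 1 * (4 / lam ^+ 2)); last by field; rewrite gt_eqF.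
  rewrite ler_pM2l// ler_pdivrMr// [leRHS]mulrAC ler_pdivlMr ?exprn_gt0//.
  apply: (@le_trans _ _ (N%:R ^+ 4 * (4 * N%:R))).
    apply: ler_pM; rewrite ?mulr_ge0 ?exprn_ge0 ?(ltW lam0)//.
      by rewrite [leRHS]exprS ler_wpM2r ?exprn_ge0.
    have -> : lam ^+ 2 = 4 * (1 / 2 * lam) ^+ 2 by field.
    by rewrite ler_pM2l.
  by rewrite mulrCA ler_pM2l// -exprSr.
have heavy : 4 * (b / N%:R `^ th) <= 16 * b / th ^+ 2 / lam ^+ 2.
  apply: (@le_trans _ _ (4 * (b / (th / 2 * lam) ^+ 2))).
    by rewrite ler_pM2l// ler_pM2l// lef_pV2 ?posrE ?exprn_gt0.
  by rewrite le_eqVlt; apply/orP; left; apply/eqP; field; rewrite !gt_eqF.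
apply: (le_trans (lerD heavy light)); rewrite -mulrDl ler_pM2r ?invr_gt0 ?exprn_gt0//.
by rewrite /C; lra.
Qed.

End Numerics.

(** * Reduction to large [N] and conclusion *)

Lemma integral_le_fin d (T : measurableType d) (R : realType)
    (P : {measure set T -> \bar R}) (f : T -> R) (v : R) : (forall w, 0 <= f w) ->
  (\int[P]_w (f w)%:E <= v%:E)%E ->
  exists2 c, (\int[P]_w (f w)%:E = c%:E)%E & c <= v.
Proof.
move=> f0 fv; have I0 : (0 <= \int[P]_w (f w)%:E)%E.
  by apply: integral_ge0 => w _; rewrite lee_fin.
by move: I0 fv; case: (\int[P]_w (f w)%:E)%E => // c _ cv; exists c.
Qed.

Theorem theorem1p3 (R : realType) (eps delta B : R)
    (heps : 0 < eps) (hdelta : 0 < delta) (hB : 0 < B) :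
  exists C : R, 0 < C /\
    forall (N : nat), (2 <= N)%N ->
    forall (d0 : measure_display) (T0 : measurableType d0)
      (P0 : probability T0 R) (x : {RV P0 >-> complex R}),
    symmetric_law P0 x ->
    ('E_P0[(fun w => normc (x w) ^+ 2)%R] <= 1%:E)%E ->
    ('E_P0[(fun w => normc (x w) `^ (2 + eps))%R] <= B%:E)%E ->
    forall (d : measure_display) (T : measurableType d) (P : probability T R)
      (X : 'I_N -> 'I_N -> {RV P >-> complex R}),
    (forall i j, same_law P P0 (X i j) x) ->
    mutually_independent P (fun ij : 'I_N * 'I_N => X ij.1 ij.2) ->
    (P [set w | ((1 + delta) * Num.sqrt N%:R
                 <= spectral_radius (\matrix_(i, j) X i j w))%R]
     <= (C / ln N%:R ^+ 2)%:E)%E.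
Proof.
(* A moment bound at least [1] lets an open path, which has one step fewer than its cycle, share the
   bound of the cycle. *)
pose b := Num.max B 1; have b1 : 1 <= b by rewrite le_max lexx orbT.
have [C C0 CP] := tail_parameters heps hdelta b1.
exists C; split=> // N N2 d0 T0 P0 x symx E1 E2 d T P X lawX indX.
have N0 : (0 < N)%N by apply: leq_trans N2.
(* If the claimed bound is at least [1], any probability satisfies it; otherwise [N] is large enough
   for the parameters. *)
have [small|/(CP N N2)[L [m [L1 r2 LN bound]]]] := leP 1 (C / ln N%:R ^+ 2).
  apply: le_trans _ (_ : (1%:E <= _)%E); last by rewrite lee_fin.
  apply: probability_le1; apply: measurable_spectral_radius_ge => //.
    by move=> i j; under eq_fun do rewrite mxE; exact: measurable_funPT.
  by rewrite mulr_gt0 ?addr_gt0// sqrtr_gt0 ltr0n.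
have [||c1 c1E c1le] := @integral_le_fin _ _ _ P0 (fun w => normc (x w) ^+ 2) 1.
- by move=> w; rewrite exprn_ge0// normc_ge0.
- by move: E1; rewrite unlock.
have [||c2 c2E c2le] := @integral_le_fin _ _ _ P0
    (fun w => (normc (x w) ^+ 2) `^ (1 + eps / 2)) B.
- by move=> w; rewrite powR_ge0.
- move: E2; rewrite unlock; apply: le_trans; rewrite le_eqVlt; apply/orP; left.
  apply/eqP; apply: eq_integral => w _; congr (_%:E).
  (* The moment of order [2 + eps] of the modulus is that of order [1 + eps / 2] of its square. *)
  rewrite -powR_mulrn ?normc_ge0// -powRrM; congr (_ `^ _).
  by field.
have c2b : c2 <= b by rewrite le_max c2le.
have p0 : 0 < 1 + eps / 2 by rewrite addr_gt0// divr_gt0.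
have t0 : 0 < (1 + delta) * Num.sqrt N%:R by rewrite mulr_gt0 ?addr_gt0// sqrtr_gt0 ltr0n.
pose X' (e : 'I_N * 'I_N) : T -> R[i] := X e.1 e.2.
have mX' e : measurable_fun setT (X' e) by exact: measurable_funPT.
have lawX' e : same_law P P0 (X' e) x by exact: lawX.
have mx : measurable_fun setT x by exact: measurable_funPT.
have := spectral_radius_tail mX' mx indX lawX' symx p0 t0 L1 c1E c1le c2E c2b b1 N0 r2 LN.
by move/le_trans; apply; rewrite lee_fin.
Qed.
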